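(* Let $(E,\star)$ be a topological group with neutral element $e_0$, where $E$ is a locally compact separable metric space. Let $h$ be a continuous group homomorphism from $(E,\star)$ to $(\mathbb{R}_+^*,\times)$, and let $L$ be a Lévy process on $(E,\star)$. For each fixed $y \in E$ define $$\forall t \in [0,+\infty],\quad \varphi_y(t) := \frac{1}{h(y)}\int_0^t \frac{1}{h(L(s))}\, ds,$$ and $$\forall\, 0 \leq t < \varphi_y(+\infty),\quad X_y(t) := y \star L(\varphi_y^{-1}(t));$$ if $\varphi_y(+\infty) < +\infty$, put $X_y(t) := \Delta$ for all $t \geq \varphi_y(+\infty)$, where $\Delta$ is a cemetery point. Then $\zeta(X_y) = \varphi_y(+\infty)$ a.s., and $X$ satisfies general self-similarity on $E$. A family of invariance components $((f_y,c_y),\ y \in E)$, for the reference point $e_0$, is given by $f_y(\cdot) := y \star \cdot$ and $c_y := h(y)$. Moreover, if we let $\xi(\cdot) := \log(1/h(L(\cdot)))$, then $\xi$ is a real Lévy process and $\zeta(X_y) = \frac{1}{h(y)}\int_0^{+\infty} e^{\xi(s)}\, ds$.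
   Context: Processes and life-time. A strongly Markovian càdlàg process $X$ on a locally compact separable metric space $E$ is given through the processes $X_y$ ($y\in E$), $X_y$ being $X$ started from $y$; $P_y$ is the law of $X_y$. The process $X_y$ may have a finite life-time $\zeta(X_y)\in(0,+\infty]$, namely the time at which every compact subset of $E$ containing $y$ has been left by $X_y$ (the limit of the first exit times from an increasing sequence of compact sets such that every compact subset of $E$ is contained in one of them). If $\mathbb{P}(\zeta(X_y)<+\infty)>0$ one adds a cemetery point $\Delta$ to $E$, whose neighborhoods are the sets $K^c\cup\{\Delta\}$, $K\subset E$ compact, and puts $X_y(t)=\Delta$ for $t\ge \zeta(X_y)$. There is no instantaneous killing: $\Delta$ is absorbing and can only be reached continuously. A homeomorphism $f$ of $E$ is extended to $E\cup\{\Delta\}$ by $f(\Delta)=\Delta$. General self-similarity. A strongly Markovian càdlàg process $X$ satisfies general self-similarity on $E$ if for some point $y_0\in E$, $$\forall y\in E,\ (X_y(t),\ t\ge 0)\overset{\mathcal L}{=}(f_y(X_{y_0}(c_y t)),\ t\ge 0),$$ where $(f_y,\ y\in E)$ is a family of homeomorphisms of $E$ such that $(y,x)\mapsto f_y(x)$ and $(y,x)\mapsto f_y^{-1}(x)$ are continuous from $E\times E$ to $E$, and $(c_y,\ y\in E)$ is a family of positive constants with $y\mapsto c_y$ continuous. Then $((f_y,c_y),\ y\in E)$ is called a family of invariance components for $X$ relatively to the reference point $y_0$. Lévy processes on groups. A Lévy process $L$ on a topological group $(E,\star)$ means a left Lévy process: a càdlàg process starting from the neutral element such that for every $t\ge0$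 the process $(L(t))^{-1}\star L(t+\cdot)$ is independent of the past of $L$ up to time $t$ and has the same law as $L$. $\mathbb{R}_+^*=]0,+\infty[$. $\varphi_y^{-1}$ is the inverse of the increasing bijection $\varphi_y:[0,+\infty[\to[0,\varphi_y(+\infty)[$. *)

(* Defs.v *)
From HB Require Import structures.
From mathcomp Require Import all_boot all_order all_algebra.
From mathcomp Require Import all_classical all_reals all_analysis.

Set Implicit Arguments.
Unset Strict Implicit.
Unset Printing Implicit Defensive.

Import Order.TTheory GRing.Theory Num.Theory.
Import numFieldNormedType.Exports.

Local Open Scope classical_set_scope.
Local Open Scope ring_scope.

Definition separable (T : topologicalType) : Prop :=
  exists2 D : set T, countable D & dense D.

Definition borel (T : topologicalType) : set (set T) := <<s @open T >>.

Section topological_groups.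
Context {E : topologicalType}.

(* The operations are explicit arguments so that the same notions apply to a
   multiplicatively written group and to the additive group of the reals. *)
Definition topological_group (mul : E -> E -> E) (inv : E -> E) (e : E) : Prop :=
  [/\ associative mul, left_id e mul, right_id e mul,
      left_inverse e inv mul & right_inverse e inv mul] /\
  continuous (fun p : E * E => mul p.1 p.2) /\ continuous inv.

Definition positive_character {R : realType} (mul : E -> E -> E) (h : E -> R)
    : Prop :=
  [/\ forall x, 0 < h x, forall x y, h (mul x y) = h x * h y & continuous h].

End topological_groups.

(* Time runs through [0, +oo[; a path or a process is a total function on R
   whose values at negative times are never looked at. *)

Section paths.
Context {R : realType} {T : topologicalType}.

Definition cadlag (x : R -> T) : Prop :=
  forall t, 0 <= t ->
    x s @[s --> t^'+] --> x t /\
    (0 < t -> exists l : T, x s @[s --> t^'-] --> l).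

Definition path_measurable : set (set (R -> T)) :=
  <<s [set C | exists t B, [/\ 0 <= t, borel B & C = [set x | B (x t)]]] >>.

End paths.

Section processes.
Context {d : measure_display} {Omega : measurableType d} {R : realType}.

Definition natural_filtration {T : topologicalType} (X : R -> Omega -> T)
    (t : R) : set (set Omega) :=
  <<s [set A | exists s B,
         [/\ 0 <= s, s <= t, borel B & A = X s @^-1` B]] >>.

Definition right_limits (F : R -> set (set Omega)) (t : R) : set (set Omega) :=
  \bigcap_(s in [set s | t < s]) F s.

Definition stopping_time (F : R -> set (set Omega)) (tau : Omega -> \bar R)
    : Prop :=
  (forall w, (0 <= tau w)%E) /\
  (forall t, 0 <= t -> F t [set w | (tau w <= t%:E)%E]).

Definition stopped_sigma (F : R -> set (set Omega)) (tau : Omega -> \bar R)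
    : set (set Omega) :=
  [set A | forall t, 0 <= t -> F t (A `&` [set w | (tau w <= t%:E)%E])].

Variable P : probability Omega R.

Definition random_process {T : topologicalType} (X : R -> Omega -> T) : Prop :=
  forall t B, 0 <= t -> borel B -> measurable (X t @^-1` B).

Definition law {T : topologicalType} (X : R -> Omega -> T) (C : set (R -> T))
    : \bar R :=
  P [set w | C (fun t => X t w)].

Definition same_law {T : topologicalType} (X Y : R -> Omega -> T) : Prop :=
  forall C, path_measurable C -> law X C = law Y C.

Definition increment {T : topologicalType} (mul : T -> T -> T) (inv : T -> T)
    (L : R -> Omega -> T) (t s : R) (w : Omega) : T :=
  mul (inv (L t w)) (L (t + s) w).

Record levy_process {T : topologicalType}
    (mul : T -> T -> T) (inv : T -> T) (e : T) (L : R -> Omega -> T) : Prop := {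
  levy_measurable : random_process L ;
  levy_cadlag : forall w, cadlag (L ^~ w) ;
  levy_start : {ae P, forall w, L 0 w = e} ;
  levy_indep : forall t, 0 <= t ->
    forall A C, natural_filtration L t A -> path_measurable C ->
    P (A `&` [set w | C (fun s => increment mul inv L t s w)]) =
    (P A * law (increment mul inv L t) C)%E ;
  levy_stationary : forall t, 0 <= t ->
    same_law (increment mul inv L t) L }.

End processes.

(* Processes on E with a cemetery point: the state space is the library's
   one-point compactification, in which None is the cemetery and the
   neighbourhoods of None are the sets containing None and the complement of a
   (closed) compact subset of E. *)

Section lifetime.
Context {R : realType} {E : topologicalType}.

Definition exit_time (K : set E) (x : R -> one_point_compactification E)
    : \bar R :=
  ereal_inf [set t%:E | t in [set t | 0 <= t /\ ~ (Some @` K) (x t)]].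

Definition lifetime (y : E) (x : R -> one_point_compactification E) : \bar R :=
  ereal_sup [set exit_time K x | K in [set K | compact K /\ K y]].

Lemma exit_timeS (K K' : set E) (x : R -> one_point_compactification E) :
  K `<=` K' -> (exit_time K x <= exit_time K' x)%E.
Proof.
move=> KK'; apply: ereal_inf_le_tmp => _ [t [t0 Kt] <-].
by exists t => //; split => // -[z Kz zx]; apply: Kt; exists z => //; exact: KK'.
Qed.

Lemma exit_time_cvg_lifetime (y : E) (x : R -> one_point_compactification E)
    (K : nat -> set E) :
  (forall n, compact (K n)) -> (forall n, K n `<=` K n.+1) ->
  (forall K', compact K' -> exists n, K' `<=` K n) ->
  exit_time (K n) x @[n --> \oo] --> lifetime y x.
Proof.
move=> cK incK exK.
suff -> : lifetime y x = ereal_sup (range (fun n => exit_time (K n) x)).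
  apply: ereal_nondecreasing_cvgn; apply/nondecreasing_seqP => n.
  exact/exit_timeS/incK.
apply/eqP; rewrite eq_le; apply/andP; split; apply: ge_ereal_sup.
  move=> _ [K' [cK' _] <-]; have [n K'n] := exK _ cK'.
  apply: (le_trans (exit_timeS x K'n)).
  by apply: ereal_sup_ubound; exists n.
move=> _ [n _ <-]; apply: (@le_trans _ _ (exit_time (K n `|` [set y]) x)).
  by apply: exit_timeS; exact: subsetUl.
apply: ereal_sup_ubound; exists (K n `|` [set y]) => //; split; last by right.
by apply: compactU; [exact: cK | exact: compact_set1].
Qed.

(* The left limit None at a finite life-time means that the cemetery is reached
   continuously, i.e. that there is no instantaneous killing. *)
Definition lifetime_path (y : E) (x : R -> one_point_compactification E)
    : Prop :=
  [/\ x 0 = Some y, cadlag x, (0 < lifetime y x)%E &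
      (lifetime y x < +oo)%E ->
        x s @[s --> (fine (lifetime y x))^'-] -->
          (None : one_point_compactification E) /\
        forall t, (lifetime y x <= t%:E)%E -> x t = None].

End lifetime.

Section self_similarity.
Context {d : measure_display} {Omega : measurableType d} {R : realType}
        {E : topologicalType}.
Variable P : probability Omega R.

Local Notation state := (one_point_compactification E).

(* X y is the process started from y. *)
Implicit Type X : E -> R -> Omega -> state.

Definition cadlag_family X : Prop :=
  forall y, random_process (X y) /\
            {ae P, forall w, lifetime_path y (fun t => X y t w)}.

Definition from_state X (z : state) : R -> Omega -> state :=
  if z is Some y then X y else fun _ _ => None.

(* The stopping times are those of the right-continuous natural filtration
   (optional times); this includes the stopping times of the natural one. *)
Definition strong_markov X : Prop :=
  (forall C : set (R -> state), path_measurable C ->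
     forall B : set (\bar R), borel B ->
     borel [set y | B (law P (X y) C)]) /\
  forall y (tau : Omega -> \bar R),
    let F := right_limits (natural_filtration (X y)) in
    stopping_time F tau ->
    forall A C, stopped_sigma F tau A -> path_measurable C ->
    let A' := A `&` [set w | (tau w < +oo)%E] in
    P (A' `&` [set w | C (fun t => X y (fine (tau w) + t) w)]) =
    (\int[P]_(w in A') law P (from_state X (X y (fine (tau w)) w)) C)%E.

(* g is the family of inverse maps; joint continuity of f and g makes every
   f y a homeomorphism. *)
Definition invariance_components X (y0 : E) (f : E -> E -> E) (c : E -> R)
    : Prop :=
  [/\ exists g : E -> E -> E,
        [/\ forall y, cancel (f y) (g y), forall y, cancel (g y) (f y),
            continuous (fun p : E * E => f p.1 p.2) &
            continuous (fun p : E * E => g p.1 p.2)],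
      forall y, 0 < c y, continuous c &
      forall y, same_law P (X y) (fun t w => omap (f y) (X y0 (c y * t) w))].

Definition general_self_similarity X : Prop :=
  [/\ cadlag_family X, strong_markov X &
      exists y0 f c, invariance_components X y0 f c].

End self_similarity.

Section time_change.
Context {R : realType} {E : topologicalType} {Omega : Type}.
Variables (mul : E -> E -> E) (h : E -> R) (L : R -> Omega -> E).

Definition phi (y : E) (w : Omega) (t : \bar R) : \bar R :=
  ((h y)^-1%:E *
   \int[lebesgue_measure]_(s in [set s : R | (0 <= s)%R /\ s%:E <= t])
     (h (L s w))^-1%:E)%E.

Definition phi_inv (y : E) (w : Omega) (t : R) : R :=
  'pinv_(fun=> 0) [set s : R | 0 <= s] (fun s : R => phi y w s%:E) t%:E.

Definition time_changed (y : E) (t : R) (w : Omega)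
    : one_point_compactification E :=
  if (t%:E < phi y w +oo)%E then Some (mul y (L (phi_inv y w t) w)) else None.

End time_change.

(* Main.v *)
Require Import Defs.
From HB Require Import structures.
From mathcomp Require Import all_boot all_order all_algebra.
From mathcomp Require Import all_classical all_reals all_analysis.
From mathcomp Require Import measurable_realfun lra.

Set Implicit Arguments.
Unset Strict Implicit.
Unset Printing Implicit Defensive.

Import Order.TTheory GRing.Theory Num.Theory.
Import numFieldNormedType.Exports.

Local Open Scope classical_set_scope.
Local Open Scope ring_scope.

(* The path of X_y is the path y * L run at the inverse of its own clock
   t |-> int_0^t ds / h(y * L(s)), so that its life-time is the total clock.
   A stopping time tau of X_y before the life-time corresponds to an optional
   time T of L; after tau the path of X_y is the same functional of
   X_y(tau) = y * L(T) and of the increments of L after T, and the strong Markov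
   property of L (discretise T) makes these increments independent of the past
   with the law of L.  Freezing the starting point then gives the strong Markov
   property of X.  Self-similarity is the effect on the clock of multiplying the
   rate by a constant.

   It remains to see that the cemetery is reached continuously, i.e. that h o L
   tends to infinity when the total clock of L is finite.  If h o L falls below b
   after time N, the strong Markov property at that moment bounds the remaining
   clock below by 1/b times an independent copy of the total clock; so finite
   total clock and dips below b at arbitrarily late times together have
   probability at most P(total clock <= b eps) for every eps > 0, hence 0. *)

(** * Measurability for the Borel sigma-algebra *)

(** Three obstacles shape the proof. Discretising [T] gives the right probabilities for each mesh,
    but passing to the limit in the probability of a set of paths is delicate: indicators are not
    continuous and the coordinate topology on paths is not metrizable. This is done for a pi-system
    of sets of paths stable under pointwise limits in a two-sided sense, then extended by Dynkin's
    theorem. Next, the total clock is an integral over uncountably many times, hence no function of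
    countably many coordinates of an arbitrary path. Freezing therefore takes place on a separate
    space of cadlag paths, whose measurable sets are traces of path events. Finally, adaptedness has
    to be carried from [X] to [L] through a random change of time. Stopping a path at [u] turns it
    into plain measurability: a quantity that depends on the stopped path only is measurable for the
    sigma-algebra of the past up to [u], so each measurability lemma is stated over an arbitrary
    measurable space and used a second time with that sigma-algebra. *)

Definition borel_fun {d} {W : measurableType d} {T : topologicalType}
    (f : W -> T) : Prop :=
  forall B, borel B -> measurable (f @^-1` B).

Lemma sigma_algebra_sub {T : Type} (G : set (set T)) (H : set (set T)) :
  H setT -> (forall A, H A -> H (~` A)) ->
  (forall F : (set T)^nat, (forall n, H (F n)) -> H (\bigcup_n F n)) ->
  G `<=` H -> <<s G >> `<=` H.
Proof.
move=> HT HC HU; apply: smallest_sub; split => //.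
- by rewrite -setCT; exact: HC.
- by move=> A; rewrite setTD; exact: HC.
Qed.

Lemma sigma_algebra_setT {T : Type} (G : set (set T)) : <<s G >> setT.
Proof.
have [G0 GC _] := smallest_sigma_algebra [set: T] G.
by rewrite -[X in smallest _ _ X]setD0; exact: GC.
Qed.

Lemma sigma_algebra_setC {T : Type} (G : set (set T)) A :
  <<s G >> A -> <<s G >> (~` A).
Proof.
have [_ GC _] := smallest_sigma_algebra [set: T] G.
by move=> GA; rewrite -setTD; exact: GC.
Qed.

Lemma sub_sigma_algebra_preimage {S T : Type} (f : S -> T) (G : set (set T))
    (H : set (set S)) : sigma_algebra setT H ->
  (forall A, G A -> H (f @^-1` A)) -> forall A, <<s G >> A -> H (f @^-1` A).
Proof.
move=> [H0 HC HU] GH; apply: sigma_algebra_sub => //.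
- by rewrite preimage_setT -setC0 -setTD; exact: HC.
- by move=> A; rewrite /= preimage_setC -setTD; exact: HC.
- by move=> F; rewrite /= preimage_bigcup; exact: HU.
Qed.

Lemma open_borel (T : topologicalType) (O : set T) : open O -> borel O.
Proof. by move=> oO X [_]; exact. Qed.

Section borel_fun.
Context {d} {W : measurableType d}.

Lemma borel_fun_open (T : topologicalType) (f : W -> T) :
  (forall O, open O -> measurable (f @^-1` O)) -> borel_fun f.
Proof.
by move=> fO B; apply: sub_sigma_algebra_preimage => //;
  exact: sigma_algebra_measurable.
Qed.

Lemma continuous_borel (T T' : topologicalType) (g : T -> T') B :
  continuous g -> borel B -> borel (g @^-1` B).
Proof.
move=> cg; apply: sub_sigma_algebra_preimage; first exact: smallest_sigma_algebra.
by move=> A oA; apply: open_borel; move/continuousP : cg; exact.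
Qed.

Lemma continuous_borel_fun (T T' : topologicalType) (g : T -> T') (f : W -> T) :
  continuous g -> borel_fun f -> borel_fun (g \o f).
Proof. by move=> cg mf B mB; exact: (mf (g @^-1` B) (continuous_borel cg mB)). Qed.

Lemma borel_fun_cst (T : topologicalType) (a : T) : borel_fun (fun _ : W => a).
Proof. by move=> B _; rewrite preimage_cst; case: ifP. Qed.

End borel_fun.

(** * Exhaustion of open sets, limits and pairs of Borel maps *)

Section open_exhaustion.
Context {R : realType} {T : pseudoMetricType R}.
Implicit Types (O : set T) (k : nat).

(* Points at distance at least 1/(k+1) from the complement of O. *)
Definition shrink O k : set T := ~` \bigcup_(c in ~` O) (ball c k.+1%:R^-1)°.

Lemma shrink_borel O k : borel (shrink O k).
Proof.
apply: sigma_algebra_setC; apply: open_borel.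
by apply: bigcup_open => c _; exact: open_interior.
Qed.

(** A limit outside [O] would be the centre of one of the removed open sets, which the sequence then
    enters for good. *)
Lemma shrink_limit O (u : nat -> T) (z : T) k : u n @[n --> \oo] --> z ->
  (forall N, exists2 n, (N <= n)%N & shrink O k (u n)) -> O z.
Proof.
move=> uz uO; apply: contrapT => Oz.
have /uz [N _ NP] : nbhs z (ball z k.+1%:R^-1)°.
  by apply/nbhs_interior/nbhsx_ballx; rewrite invr_gt0.
have [n Nn] := uO N; apply; exists z => //; exact: NP.
Qed.

Lemma shrink_nd O k k' : (k <= k')%N -> shrink O k `<=` shrink O k'.
Proof.
move=> kk' z zk [c Oc cz]; apply: zk; exists c => //.
apply: (interiorS _ cz); apply: le_ball.
by rewrite lef_pV2 ?posrE// ler_nat ltnS.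
Qed.

Lemma open_shrink O z : open O -> O z ->
  exists k, \forall z' \near z, shrink O k z'.
Proof.
move=> oO Oz; have /nbhs_ballP[e /= e0 eO] : nbhs z O by exact: open_nbhs_nbhs.
have e20 : 0 < e / 2 by rewrite divr_gt0.
have [k _ /(_ k (leqnn _)) ke] := near_infty_natSinv_lt (PosNum e20).
exists k; apply: filterS (nbhsx_ballx z _ e20) => z' zz' [c Oc].
move=> /interior_subset cz'; apply: Oc; apply: eO.
rewrite (splitr e); apply: (ball_triangle zz').
by apply/ball_sym/(le_ball _ cz')/ltW.
Qed.

Lemma open_cvg_shrink O (u : nat -> T) (z : T) : open O -> u n @[n --> \oo] --> z ->
  O z -> exists k, \forall n \near \oo, shrink O k (u n).
Proof. by move=> oO uz /(open_shrink oO)[k zk]; exists k; exact: uz. Qed.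

End open_exhaustion.

(** The preimage of an open set is a union over [k] of lower limits: convergence into [O] forces the
    sequence into some fixed [shrink O k] eventually, and conversely [shrink_limit] keeps the limit
    in [O]. *)
Lemma borel_fun_cvg {d} {W : measurableType d} {R : realType}
    {T : pseudoMetricType R} (u : nat -> W -> T) (f : W -> T) :
  (forall n, borel_fun (u n)) -> (forall w, u n w @[n --> \oo] --> f w) ->
  borel_fun f.
Proof.
move=> mu uf; apply: borel_fun_open => O oO.
rewrite (_ : f @^-1` O = \bigcup_k \bigcup_N \bigcap_(n in [set n | (N <= n)%N])
    (u n @^-1` shrink O k)); last first.
  apply/seteqP; split=> [w Ow|w [k _ [N _ NO]]].
    have [k [N _ NO]] := open_cvg_shrink oO (uf w) Ow.
    by exists k => //; exists N.
  apply: (shrink_limit (uf w)) => N'; exists (maxn N N'); first exact: leq_maxr.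
  by apply: NO; exact: leq_maxl.
apply: bigcupT_measurable => k; apply: bigcupT_measurable => N.
by apply: bigcap_measurable => [|n _]; [exists N => /=|exact: (mu n _ (shrink_borel O k))].
Qed.

Lemma countable_bigcup_measurable {d} {W : measurableType d} {I : Type}
    (D : set I) (F : I -> set W) : countable D ->
  (forall i, D i -> measurable (F i)) -> measurable (\bigcup_(i in D) F i).
Proof.
move=> cD mF; rewrite bigcup_set_type; apply: countable_bigcupT_measurable.
  by rewrite (eq_countable (card_setT D)).
by move=> i; apply: mF; exact: set_valP.
Qed.

(** Separability writes an open set of the product as a countable union of rectangles centred at
    points of the dense sets; rectangles have measurable preimages. *)
Lemma borel_fun_pair {d} {W : measurableType d} {R : realType}
    {T1 T2 : pseudoMetricType R} (f : W -> T1) (g : W -> T2) :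
  Defs.separable T1 -> Defs.separable T2 -> borel_fun f -> borel_fun g ->
  borel_fun (fun w => (f w, g w)).
Proof.
move=> [D1 cD1 dD1] [D2 cD2 dD2] mf mg; apply: borel_fun_open => O oO.
pose B (p : T1 * T2 * nat) : set (T1 * T2) :=
  (ball p.1.1 p.2.+1%:R^-1)° `*` (ball p.1.2 p.2.+1%:R^-1)°.
rewrite (_ : _ @^-1` O = \bigcup_(p in [set p | [/\ D1 p.1.1, D2 p.1.2 &
    B p `<=` O]]) ((fun w => (f w, g w)) @^-1` B p)); last first.
  apply/seteqP; split=> [w Ow|w [p [_ _ pO] /pO]//].
  have /nbhs_ballP[e /= e0 eO] : nbhs (f w, g w) O by exact: open_nbhs_nbhs.
  have e20 : 0 < e / 2 by rewrite divr_gt0.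
  have [k _ /(_ k (leqnn _)) /= ke] := near_infty_natSinv_lt (PosNum e20).
  (* The centres are taken within half the radius, so that the point lies in the interior of the
     ball and not merely in the ball. *)
  have r0 : 0 < k.+1%:R^-1 / 2 :> R by rewrite divr_gt0.
  have rle : k.+1%:R^-1 / 2 <= k.+1%:R^-1 :> R.
    by rewrite ler_pdivrMr// ler_peMr// ler1n.
  have near (T : pseudoMetricType R) (D : set T) (x : T) : dense D ->
      exists2 a, D a & ball x (k.+1%:R^-1 / 2) a.
    move=> dD; have /dD /(_ (open_interior _))[a [/interior_subset xa Da]] :
      (ball x (k.+1%:R^-1 / 2))° !=set0.
      by exists x; exact/nbhsx_ballx.
    by exists a.
  have [a Da fa] := near _ D1 (f w) dD1.
  have [b Db gb] := near _ D2 (g w) dD2.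
  have inter (T : pseudoMetricType R) (x c : T) : ball x (k.+1%:R^-1 / 2) c ->
      (ball c k.+1%:R^-1)° x.
    move=> xc; apply/nbhs_ballP; exists (k.+1%:R^-1 / 2) => //= z xz.
    by rewrite [_^-1]splitr; apply: ball_triangle xz; exact: ball_sym.
  exists (a, b, k); last by split; exact: inter.
  split=> // -[z1 z2] [/= /interior_subset az /interior_subset bz].
  apply: eO; split; rewrite /= (splitr e).
    exact: (ball_triangle (le_ball (le_trans rle (ltW ke)) fa)
      (le_ball (ltW ke) az)).
  exact: (ball_triangle (le_ball (le_trans rle (ltW ke)) gb)
    (le_ball (ltW ke) bz)).
apply: countable_bigcup_measurable => [|p _].
  apply: sub_countable (countableX (countableX cD1 cD2) (countableP [set: nat])).
  by apply: subset_card_le => p [? ? _]; split=> //; split.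
have -> : (fun w => (f w, g w)) @^-1` B p =
  f @^-1` (ball p.1.1 p.2.+1%:R^-1)° `&` g @^-1` (ball p.1.2 p.2.+1%:R^-1)°.
  by apply/seteqP; split.
by apply: measurableI; [apply: mf|apply: mg];
  apply: open_borel; exact: open_interior.
Qed.

Section borel_real.
Context {d} {W : measurableType d} {R : realType}.

Lemma borel_fun_measurable (f : W -> R) : borel_fun f -> measurable_fun setT f.
Proof.
move=> mf; apply: (measurability _ (RGenInftyO.measurableE R)).
move=> _ [_ [x ->] <-]; rewrite setTI; apply: mf.
by apply: open_borel; exact: interval_open.
Qed.

Lemma measurable_lt_real (f : W -> R) :
  (forall x, measurable [set w | f w < x]) -> measurable_fun setT f.
Proof.
move=> mf; apply: (measurability _ (RGenInftyO.measurableE R)).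
move=> _ [_ [x ->] <-]; rewrite setTI.
by rewrite (_ : _ @^-1` _ = [set w | f w < x])//; apply/seteqP; split => w /=;
  rewrite in_itv.
Qed.

End borel_real.

(** * Approximation of times from the right *)

Section discretisation.
Context {R : realType}.

(* The next point of the grid of mesh 1/(n+1) strictly to the right of s. *)
Definition grid_above (n : nat) (s : R) : R :=
  (Num.truncn (n.+1%:R * s)).+1%:R / n.+1%:R.

Lemma grid_above_gt n s : s < grid_above n s.
Proof. by rewrite ltr_pdivlMr// mulrC truncnS_gt. Qed.

Lemma grid_above_le n s : 0 <= s -> grid_above n s <= s + n.+1%:R^-1.
Proof.
move=> s0; rewrite ler_pdivrMr// mulrDl mulVf// -natr1 lerD2r mulrC.
by rewrite truncn_le mulr_ge0.
Qed.

Lemma grid_above_cvg s : 0 <= s -> grid_above n s @[n --> \oo] --> s^'+.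
Proof.
move=> s0 A /nbhs_ballP[e /= e0 eA].
have [N _ NP] := near_infty_natSinv_lt (PosNum e0).
exists N => // n /NP /= ne; apply: eA; last exact: grid_above_gt.
rewrite /ball/= ltr0_norm ?subr_lt0 ?grid_above_gt//.
by rewrite opprB ltrBlDl (le_lt_trans (grid_above_le n s0))// ltrD2l.
Qed.

Lemma grid_above_eq n k s : 0 <= s ->
  (grid_above n s == k.+1%:R / n.+1%:R) =
  (k%:R / n.+1%:R <= s < k.+1%:R / n.+1%:R).
Proof.
move=> s0; rewrite /grid_above eqr_div// (inj_eq (mulIf _))// eqr_nat eqSS.
by rewrite truncn_eq ?mulr_ge0// ler_pdivrMr// ltr_pdivlMr// mulrC.
Qed.

End discretisation.

Section right_continuous_process.
Context {d} {W : measurableType d} {R : realType} {T : pseudoMetricType R}.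
Variable Y : R -> W -> T.
Hypothesis mY : forall s, 0 <= s -> borel_fun (Y s).
Hypothesis cY : forall w s, 0 <= s -> Y u w @[u --> s^'+] --> Y s w.

(** Sampled at the next grid point, the process is constant in time on each cell, hence jointly
    Borel; right continuity recovers [Y] in the limit. The [max] replaces negative times, at which
    paths are arbitrary, by 0. *)
Lemma borel_fun_jointly : borel_fun (fun p : R * W => Y (Num.max p.1 0) p.2).
Proof.
pose Yn n (p : R * W) := Y (grid_above n (Num.max p.1 0)) p.2.
apply: (@borel_fun_cvg _ _ _ _ Yn) => [n|[s w]]; last first.
  have s0 : 0 <= Num.max s 0 by rewrite le_max lexx orbT.
  apply: (@cvg_comp _ _ _ (fun n => grid_above n (Num.max s 0)) (Y ^~ w));
    [exact: grid_above_cvg|exact: cY].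
apply: borel_fun_open => O oO.
pose I k := [set s : R | grid_above n (Num.max s 0) = k.+1%:R / n.+1%:R].
rewrite (_ : _ @^-1` _ = \bigcup_k (I k `*` (Y (k.+1%:R / n.+1%:R) @^-1` O))).
  apply: bigcupT_measurable => k; apply: measurableX; last first.
    by apply: mY; [rewrite divr_ge0|exact: open_borel].
  rewrite (_ : I k = (fun s => Num.max s 0) @^-1`
      [set` `[k%:R / n.+1%:R, k.+1%:R / n.+1%:R[]); last first.
    apply/seteqP; split=> s; rewrite /I/= in_itv/=.
      by move/eqP; rewrite grid_above_eq// le_max lexx orbT.
    by rewrite -grid_above_eq ?le_max ?lexx ?orbT// => /eqP.
  rewrite -[X in measurable X]setTI.
  apply: (measurable_maxr (@measurable_id _ _ _) (measurable_cst _)) => //.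
apply/seteqP; split=> [[s w] sO|[s w] [k _ [/= sk kO]]].
  by exists (Num.truncn (n.+1%:R * Num.max s 0)).
by rewrite /Yn/= sk.
Qed.

Lemma borel_fun_random_time (theta : W -> R) : measurable_fun setT theta ->
  (forall w, 0 <= theta w) -> borel_fun (fun w => Y (theta w) w).
Proof.
move=> mt t0 B mB.
rewrite (_ : _ @^-1` B = setT `&` (fun w => (theta w, w)) @^-1`
    ((fun p : R * W => Y (Num.max p.1 0) p.2) @^-1` B)).
  by apply: measurable_fun_pair => //; exact: borel_fun_jointly.
by rewrite setTI; apply/seteqP; split=> w /=; rewrite (max_l (t0 w)).
Qed.

End right_continuous_process.

(** * Clocks *)

Section lebesgue_shift.
Context {R : realType}.
Local Notation mu := (@lebesgue_measure R).

(** The translated measure gives half-open intervals their length, so it is Lebesgue measure by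
    uniqueness; the rest is integration against a pushforward. *)
Lemma lebesgue_shift (a : R) (D : set R) (f : R -> \bar R) :
  measurable D -> measurable_fun D f -> (forall x, D x -> 0 <= f x)%E ->
  (\int[mu]_(x in D) f x = \int[mu]_(x in [set x | D (a + x)%R]) f (a + x)%R)%E.
Proof.
move=> mD mf f0.
pose tr (x : R) : measurableTypeR R := a + x.
have mtr : measurable_fun [set: R] tr by exact: measurable_funD.
have munu A : measurable A -> pushforward mu tr A = mu A.
  move=> mA; apply/esym/lebesgue_measure_unique => //= _ [[x y] _ <-].
  have -> : pushforward mu tr `]x, y]%classic = mu `]x - a, y - a]%classic.
    by congr (mu _); apply/seteqP; split=> z; rewrite /tr/= !in_itv/=; lra.
  rewrite !lebesgue_measure_itv/= !lte_fin ltrD2r.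
  by case: ifP => // _; rewrite -!EFinB; congr EFin; lra.
transitivity (\int[pushforward mu tr]_(x in D) f x)%E.
  by apply: eq_measure_integral => //= A mA _; exact/esym/munu.
by rewrite ge0_integral_pushforward// => x /set_mem; exact: f0.
Qed.

End lebesgue_shift.

Section clock.
Context {R : realType}.
Local Notation mu := (@lebesgue_measure R).
Implicit Types (g : R -> R) (s t u a : R).

Definition clock g (t : \bar R) : \bar R :=
  (\int[mu]_(s in [set s : R | (0 <= s)%R /\ s%:E <= t]) (g s)%:E)%E.

(** Positivity makes the clock strictly increasing; local boundedness makes it finite and continuous
    at finite times. Its value at [+oo] may be infinite. *)
Record clock_rate g : Prop := {
  rate_measurable : measurable_fun (`[0, +oo[%classic : set R) g ;
  rate_gt0 : forall s, 0 <= s -> 0 < g s ;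
  rate_bounded : forall t, exists M, forall s, 0 <= s <= t -> g s <= M }.

Lemma clock_domE t : [set s : R | 0 <= s /\ (s%:E <= t%:E)%E] = `[0, t]%classic.
Proof. by apply/seteqP; split=> s; rewrite /= in_itv/= lee_fin => /andP. Qed.

Lemma clock_domy : [set s : R | 0 <= s /\ (s%:E <= +oo)%E] = `[0, +oo[%classic.
Proof.
by apply/seteqP; split=> s; rewrite /= in_itv/= andbT leey// => -[].
Qed.

Lemma measurable_clock_dom (t : \bar R) :
  measurable [set s : R | 0 <= s /\ (s%:E <= t)%E].
Proof.
case: t => [t||]; first by rewrite clock_domE; exact: measurable_itv.
  by rewrite clock_domy; exact: measurable_itv.
rewrite (_ : [set _ | _] = set0); first exact: measurable0.
by apply/seteqP; split=> // s [_]; rewrite leeNy_eq.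
Qed.

Lemma clock0 g : clock g 0%:E = 0%E.
Proof. by rewrite /clock clock_domE set_itv1 integral_set1. Qed.

Lemma eq_clock g g' (t : \bar R) :
  (forall s, 0 <= s -> (s%:E <= t)%E -> g s = g' s) -> clock g t = clock g' t.
Proof.
by move=> gg'; apply: eq_integral => s /set_mem[s0 st]; rewrite gg'.
Qed.

Lemma clock_rate_shift g a : 0 <= a -> clock_rate g ->
  clock_rate (fun s => g (a + s)).
Proof.
move=> a0 [mg g0 gb]; split.
- rewrite (_ : (fun _ => _) = g \o (fun s => a + s))//.
  apply: (measurable_comp (F := (`[0, +oo[%classic : set R))) => //.
    by move=> _ [s + <-]; rewrite /= !in_itv/= !andbT => s0; rewrite addr_ge0.
  by apply: measurable_funTS; apply: measurable_funD.
- by move=> s s0; apply: g0; rewrite addr_ge0.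
- move=> t; have [M gM] := gb (a + t); exists M => s /andP[s0 st].
  by apply: gM; rewrite addr_ge0//= lerD2l.
Qed.

Section rate.
Variable g : R -> R.
Hypothesis rg : clock_rate g.

Let mg (t : \bar R) :
  measurable_fun [set s : R | 0 <= s /\ (s%:E <= t)%E] (EFin \o g).
Proof.
apply/measurable_EFinP; apply: measurable_funS (rate_measurable rg).
  exact: measurable_itv.
by move=> s [s0 _]; rewrite /= in_itv/= s0.
Qed.

Let g0 (t : \bar R) s : 0 <= s /\ (s%:E <= t)%E -> (0 <= (g s)%:E)%E.
Proof. by move=> [s0 _]; rewrite lee_fin ltW// (rate_gt0 rg). Qed.

Lemma clock_ge0 (t : \bar R) : (0 <= clock g t)%E.
Proof. by apply: integral_ge0 => s; exact: g0. Qed.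

Lemma rate_integrable t : mu.-integrable `[0, t]%classic (EFin \o g).
Proof.
have [M gM] := rate_bounded rg t.
apply: measurable_bounded_integrable.
- exact: measurable_itv.
- rewrite [X in (X < _)%E](@lebesgue_measure_itv R `[0, t])/=.
  by case: ifP => // _; rewrite -EFinB ltry.
- by have /measurable_EFinP := @mg t%:E; rewrite clock_domE.
- exists M; split; first exact: num_real.
  move=> N MN s /=; rewrite in_itv/= => st.
  by rewrite gtr0_norm ?(le_trans (gM _ st)) ?ltW// (rate_gt0 rg)//; case/andP: st.
Qed.

Lemma clock_fin t : clock g t%:E \is a fin_num.
Proof.
rewrite /clock clock_domE.
have mt : measurable (`[0, t]%classic : set R) by exact: measurable_itv.
exact: (@integrable_fin_num _ _ _ mu _ mt (EFin \o g) (rate_integrable t)).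
Qed.

Lemma clock_shift a (t : \bar R) : 0 <= a -> (0 <= t)%E ->
  clock g (a%:E + t)%E = (clock g a%:E + clock (fun s => g (a + s)) t)%E.
Proof.
move=> a0 t0.
pose D := [set s : R | 0 <= s /\ (s%:E <= a%:E + t)%E].
pose B := [set s : R | a <= s /\ (s%:E <= a%:E + t)%E].
have DE : D = `[0, a[%classic `|` B.
  apply/seteqP; split=> s; rewrite /D/B/= in_itv/=.
    by move=> [s0 sat]; case: (ltP s a) => sa; [left; rewrite s0|right].
  move=> [/andP[s0 /ltW sa]|[sa sat]]; split => //.
    by rewrite (le_trans (_ : (_ <= a%:E)%E)) ?lee_fin// leeDl.
  exact: le_trans sa.
have mB : measurable B.
  rewrite (_ : B = D `&` `[a, +oo[%classic).
    by apply: measurableI; [exact: measurable_clock_dom|exact: measurable_itv].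
  apply/seteqP; split=> s; rewrite /B/D/= in_itv/= andbT.
    by move=> [as_ ?]; do 2?split => //; exact: le_trans as_.
  by move=> [[? ?] ?].
have mD : measurable_fun D (EFin \o g) by exact: mg.
rewrite /clock -/D DE ge0_integral_setU//=; first last.
- rewrite disj_set2E; apply/eqP/seteqP; split=> // s [] /=.
  by rewrite in_itv/= => /andP[_ sa] [as_ _]; move: sa; rewrite ltNge as_.
- by move=> s Ds; apply: (@g0 (a%:E + t)%E); have : D s by rewrite DE.
- by rewrite -DE.
have BD : B `<=` D by rewrite DE; exact: subsetUr.
congr (_ + _)%E.
  rewrite clock_domE; apply: integral_itv_bndo_bndc.
  by apply: measurable_funS mD; [exact: measurable_clock_dom|rewrite DE; exact: subsetUl].
rewrite (@lebesgue_shift _ a B)//.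
- congr (integral _ _ _); apply/seteqP; split=> s; rewrite /B/=.
    by rewrite lerDl EFinD leeD2lE.
  by rewrite lerDl EFinD leeD2lE.
- by apply: measurable_funS mD; first exact: measurable_clock_dom.
- by move=> s /BD; exact: g0.
Qed.

(** If the integral of a positive function vanished, its domain would be a null set, yet the domain
    contains an interval of positive length. *)
Lemma clock_gt0 (t : \bar R) : (0 < t)%E -> (0 < clock g t)%E.
Proof.
move=> t0; rewrite lt_neqAle clock_ge0 andbT eq_sym; apply/negP => /eqP I0.
pose D := [set s : R | 0 <= s /\ (s%:E <= t)%E].
have mD : measurable D by exact: measurable_clock_dom.
have /(ae_eq_integral_abs mu mD (@mg t)) [N [mN N0 DN]] :
    (\int[mu]_(s in D) `|(g s)%:E| = 0)%E.
  by rewrite -I0; apply: eq_integral => s /set_mem /g0 ?; rewrite gee0_abs.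
have {}DN : D `<=` N.
  move=> s Ds; apply: DN => /(_ Ds)/= [gs].
  by have := rate_gt0 rg Ds.1; rewrite gs ltxx.
have [e e0 eD] : exists2 e : R, 0 < e & `]0, e[%classic `<=` D.
  move: t0 @D {mD I0 DN}; case: t => [t||]//=; rewrite ?lte_fin => t0.
    exists t => // s; rewrite /= in_itv/= lee_fin => /andP[/ltW ? /ltW ?].
    by split.
  by exists 1 => // s; rewrite /= in_itv/= leey => /andP[/ltW].
have : (mu `]0%R, e[%classic <= 0)%E.
  rewrite -N0; apply: le_measure; rewrite ?inE//.
  exact: subset_trans eD DN.
by rewrite lebesgue_measure_itv/= lte_fin e0 leNgt -EFinB lte_fin subr0 e0.
Qed.

End rate.

(** * The inverse of the clock *)

Section inverse.
Variable g : R -> R.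
Hypothesis rg : clock_rate g.

Lemma clock_lt s (t : \bar R) : 0 <= s -> (s%:E < t)%E ->
  (clock g s%:E < clock g t)%E.
Proof.
move=> s0 st; have [u u0 ->] : exists2 u, (0 < u)%E & t = (s%:E + u)%E.
  case: t st => [t||//] st; last by exists +oo%E => //; exact: ltry.
  by exists (t - s)%:E; rewrite ?lte_fin ?subr_gt0// -EFinD subrKC.
by rewrite clock_shift ?(ltW u0)// lteDl ?clock_fin// (clock_gt0 (clock_rate_shift s0 rg)).
Qed.
Lemma clock_le s (t : \bar R) : 0 <= s -> (s%:E <= t)%E ->
  (clock g s%:E <= clock g t)%E.
Proof.
by move=> s0; rewrite le_eqVlt => /predU1P[->//|/(clock_lt s0)/ltW].
Qed.

Lemma clock_cvgy : clock g n%:R%:E @[n --> \oo] --> clock g +oo%E.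
Proof.
pose D (n : nat) := [set s : R | 0 <= s /\ (s%:E <= n%:R%:E)%E].
have -> : clock g +oo%E = (\int[mu]_(s in \bigcup_n D n) (g s)%:E)%E.
  congr (integral _ _ _); apply/seteqP; split=> s /=.
    move=> [s0 _]; exists (Num.truncn s).+1 => //; split => //.
    by rewrite lee_fin ltW// truncnS_gt.
  by move=> [n _ [s0 _]]; rewrite leey.
apply: (@ge0_nondecreasing_set_cvg_integral _ (measurableTypeR R) R D
  (EFin \o g) mu).
- move=> m n mn; apply/subsetPset => s [s0 sm]; split => //.
  by rewrite (le_trans sm)// lee_fin ler_nat.
- by move=> n; exact: measurable_clock_dom.
- move=> n; apply/measurable_EFinP; apply: measurable_funS (rate_measurable rg).
    exact: measurable_itv.
  by move=> s [s0 _]; rewrite /= in_itv/= s0.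
- by move=> n s [s0 _]; rewrite /= lee_fin ltW// (rate_gt0 rg).
Qed.

Lemma clock_exceeds t : (t%:E < clock g +oo)%E ->
  exists2 u, 0 <= u & (t%:E < clock g u%:E)%E.
Proof.
move=> tg; apply: contrapT => nex; move: tg; apply/negP; rewrite -leNgt.
apply: (cvge_le _ clock_cvgy); apply: nearW => n; rewrite leNgt.
by apply/negP => tn; apply: nex; exists n%:R.
Qed.

Lemma clock_surj t : 0 <= t -> (t%:E < clock g +oo)%E ->
  exists2 u, 0 <= u & clock g u%:E = t%:E.
Proof.
move=> t0 /clock_exceeds[v v0 tv].
have vE u : clock g u%:E = (parameterized_integral mu 0 u g)%:E.
  rewrite /parameterized_integral /Rintegral.
  by rewrite -clock_domE fineK// clock_fin.
have := IVT v0 (parameterized_integral_continuous v0 (rate_integrable rg v)).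
move=> /(_ t)[|u]; last first.
  by rewrite in_itv/= => /andP[u0 _] ut; exists u => //; rewrite vE ut.
rewrite ge_min le_max.
rewrite -[t <= parameterized_integral mu 0 v g]lee_fin -vE (ltW tv) orbT andbT.
by rewrite -lee_fin -vE clock0 lee_fin t0.
Qed.

(** Spelled like [phi_inv], so that the two coincide once [phi] is recognised as a clock. *)
Definition clock_inv t : R :=
  'pinv_(fun=> 0) [set s : R | 0 <= s] (fun s : R => clock g s%:E) t%:E.

Lemma clock_inj s t : 0 <= s -> 0 <= t -> clock g s%:E = clock g t%:E -> s = t.
Proof.
move=> s0 t0 st; have [ts|ts|//] := ltgtP s t.
  by have := @clock_lt s t%:E s0; rewrite lte_fin st ltxx => /(_ ts).
by have := @clock_lt t s%:E t0; rewrite lte_fin st ltxx => /(_ ts).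
Qed.

Lemma clock_invE u t : 0 <= u -> clock g u%:E = t%:E -> clock_inv t = u.
Proof.
move=> u0 ut; rewrite /clock_inv -ut.
apply: (@pinvKV _ _ _ _ (fun s : R => clock g s%:E)); last by rewrite inE.
by move=> a b /set_mem a0 /set_mem b0; exact: clock_inj.
Qed.

Section inverse_at.
Variable t : R.
Hypotheses (t0 : 0 <= t) (ty : (t%:E < clock g +oo)%E).

Lemma clock_inv_ge0 : 0 <= clock_inv t.
Proof. by have [u u0 /(clock_invE u0) ->] := clock_surj t0 ty. Qed.

Lemma clock_invK : clock g (clock_inv t)%:E = t%:E.
Proof. by have [u u0 ut] := clock_surj t0 ty; rewrite (clock_invE u0 ut). Qed.

(** Trades a bound on the inverse for a bound on the clock at the fixed time [u], which involves the
    path only up to [u]. Measurability, adaptedness and one-sided continuity of the inverse all rest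
    on this and on its mirror image. *)
Lemma clock_inv_lt u : 0 <= u -> (clock_inv t < u) = (t%:E < clock g u%:E)%E.
Proof.
move=> u0; rewrite -clock_invK; apply/idP/idP => [|].
  by move/(@clock_lt _ u%:E clock_inv_ge0).
by rewrite ltNge; apply: contraNlt => /(@clock_le _ (clock_inv t)%:E u0).
Qed.

Lemma clock_inv_gt u : 0 <= u -> (u < clock_inv t) = (clock g u%:E < t%:E)%E.
Proof.
move=> u0; rewrite -clock_invK; apply/idP/idP => [|].
  by move/(@clock_lt _ (clock_inv t)%:E u0).
by rewrite ltNge; apply: contraNlt => /(@clock_le _ u%:E clock_inv_ge0).
Qed.

End inverse_at.

Lemma clock_lty u t : 0 <= u -> (t%:E < clock g u%:E)%E -> (t%:E < clock g +oo)%E.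
Proof. by move=> u0 /lt_le_trans; apply; apply: clock_le => //; exact: leey. Qed.

(** The target is a one-sided filter, thanks to strict monotonicity: a cadlag path has only
    one-sided limits, so ordinary continuity of the inverse could not be composed with it. *)
Lemma clock_inv_right t : 0 <= t -> (t%:E < clock g +oo)%E ->
  clock_inv s @[s --> t^'+] --> (clock_inv t)^'+.
Proof.
move=> t0 ty A /nbhs_ballP[e /= e0 eA].
have i0 := clock_inv_ge0 t0 ty.
have ie0 : 0 <= clock_inv t + e by rewrite addr_ge0// ltW.
have : (t%:E < clock g (clock_inv t + e)%:E)%E.
  by rewrite -clock_inv_lt// ltrDl.
rewrite -(fineK (clock_fin rg _)) lte_fin => te.
suff : \forall s \near t^'+, A (clock_inv s) by [].
near=> s.
have s0 : 0 <= s by rewrite (le_trans t0)//; near: s; exact: nbhs_right_ge.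
have se : (s%:E < clock g (clock_inv t + e)%:E)%E.
  by rewrite -(fineK (clock_fin rg _)) lte_fin; near: s; exact: nbhs_right_lt.
have sy := clock_lty ie0 se.
have ts : clock_inv t < clock_inv s.
  by rewrite clock_inv_gt// clock_invK// lte_fin; near: s; exact: nbhs_right_gt.
apply: eA => //; rewrite /ball/= ltr0_norm ?subr_lt0// opprB ltrBlDl.
by rewrite clock_inv_lt.
Unshelve. all: by end_near. Qed.

Lemma clock_inv_left t : 0 < t -> (t%:E < clock g +oo)%E ->
  clock_inv s @[s --> t^'-] --> (clock_inv t)^'-.
Proof.
move=> t0 ty A /nbhs_ballP[e /= e0 eA].
have i0 := clock_inv_ge0 (ltW t0) ty.
(* The truncation keeps [u] among the times where the clock is controlled; as [0 < t], it stays
   strictly below [clock_inv t]. *)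
pose u := Num.max 0 (clock_inv t - e).
have u0 : 0 <= u by rewrite le_max lexx.
have : (clock g u%:E < t%:E)%E.
  rewrite -clock_inv_gt ?(ltW t0)// gt_max gtrBl e0 andbT.
  by rewrite clock_inv_gt ?(ltW t0)// clock0 lte_fin.
rewrite -(fineK (clock_fin rg _)) lte_fin => ut.
suff : \forall s \near t^'-, A (clock_inv s) by [].
near=> s.
have s0 : 0 <= s by near: s; exact: nbhs_left_ge.
have st : s < t by near: s; exact: nbhs_left_lt.
have sy : (s%:E < clock g +oo)%E by rewrite (lt_trans _ ty)// lte_fin.
have ts : clock_inv s < clock_inv t by rewrite clock_inv_lt// clock_invK ?(ltW t0)// lte_fin.
apply: eA => //; rewrite /ball/= gtr0_norm ?subr_gt0// ltrBlDr -ltrBlDl.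
suff : u < clock_inv s by rewrite gt_max => /andP[].
rewrite clock_inv_gt// -(fineK (clock_fin rg _)) lte_fin.
by near: s; exact: nbhs_left_gt.
Unshelve. all: by end_near. Qed.

Lemma clock_inv_lifetime : (clock g +oo < +oo)%E ->
  clock_inv s @[s --> (fine (clock g +oo%E))^'-] --> +oo.
Proof.
move=> gy; have gfin : clock g +oo%E \is a fin_num.
  by rewrite ge0_fin_numE ?clock_ge0.
apply/cvgryPgt => a; pose u := Num.max 0 a.
have u0 : 0 <= u by rewrite le_max lexx.
have : (clock g u%:E < clock g +oo)%E by apply: clock_lt => //; exact: ltry.
rewrite -(fineK (clock_fin rg _)) -(fineK gfin) lte_fin => ut.
near=> s.
have us : fine (clock g u%:E) < s by near: s; exact: nbhs_left_gt.
have s0 : 0 <= s by rewrite (le_trans _ (ltW us))// fine_ge0// clock_ge0.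
have sy : (s%:E < clock g +oo)%E.
  by rewrite -(fineK gfin) lte_fin; near: s; exact: nbhs_left_lt.
apply: (le_lt_trans (_ : a <= u)); first by rewrite le_max lexx orbT.
by rewrite clock_inv_gt// -(fineK (clock_fin rg _)) lte_fin.
Unshelve. all: by end_near. Qed.

End inverse.
End clock.

(** * Time change of a cadlag path *)

Section cadlag_paths.
Context {R : realType} {E : metricType R}.
Implicit Types x : R -> E.

Lemma cadlag_shift x a : 0 <= a -> cadlag x -> cadlag (fun s => x (a + s)).
Proof.
move=> a0 cx t t0.
have trR : (a + s) @[s --> t^'+] --> (a + t)^'+.
  move=> A /nbhs_ballP[e /= e0 eA]; apply/nbhs_ballP; exists e => // s.
  rewrite /ball/= => st ts; apply: eA; last by rewrite /= ltrD2l.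
  by rewrite /ball/= (_ : _ - _ = t - s)//; lra.
have trL : (a + s) @[s --> t^'-] --> (a + t)^'-.
  move=> A /nbhs_ballP[e /= e0 eA]; apply/nbhs_ballP; exists e => // s.
  rewrite /ball/= => st ts; apply: eA; last by rewrite /= ltrD2l.
  by rewrite /ball/= (_ : _ - _ = t - s)//; lra.
have [rx lx] := cx (a + t) (addr_ge0 a0 t0); split.
  exact: (cvg_comp _ _ trR rx).
move=> t1; have [|l xl] := lx _; first by rewrite ltr_wpDl.
by exists l; exact: (cvg_comp _ _ trL xl).
Qed.

Lemma cadlag_continuous {T T' : topologicalType} (f : T -> T') (x : R -> T) :
  continuous f -> cadlag x -> cadlag (f \o x).
Proof.
move=> cf cx t t0; have [rx lx] := cx t t0; split.
  by apply: (cvg_comp _ _ rx); exact: cf.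
move=> t1; have [l xl] := lx t1; exists (f l).
by apply: (cvg_comp _ _ xl); exact: cf.
Qed.

(** The stopped path depends on the past up to [u] alone and still has the regularity required by
    the measurability lemmas. *)
Lemma cadlag_stop x u : 0 <= u -> cadlag x -> cadlag (fun s => x (Num.min s u)).
Proof.
move=> u0 cx t t0; have [rx lx] := cx t t0.
have cstR (a : R) : a <= t -> \forall s \near t^'+, a <= s.
  by move=> at_; near=> s; rewrite (le_trans at_)//; near: s; exact: nbhs_right_ge.
have [tu|ut] := ltP t u.
  split.
    apply: cvg_trans rx; apply: near_eq_cvg.
    by near=> s; rewrite min_l// ltW//; near: s; exact: nbhs_right_lt.
  move=> t1; have [l xl] := lx t1; exists l.
  apply: cvg_trans xl; apply: near_eq_cvg.
  near=> s; rewrite min_l//; apply: le_trans (ltW tu); near: s.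
  exact: nbhs_left_le.
split.
  apply: cvg_near_cst.
  by near=> s; rewrite min_r//; near: s; exact: cstR.
move=> t1; move: ut; rewrite le_eqVlt => /predU1P[ut|ut].
  have [l xl] := lx t1; exists l.
  apply: cvg_trans xl; apply: near_eq_cvg.
  near=> s; rewrite min_l// ut ltW//; near: s; exact: nbhs_left_lt.
exists (x u); apply: cvg_near_cst.
near=> s; rewrite min_r// ltW//; near: s; exact: nbhs_left_gt.
Unshelve. all: by end_near. Qed.

(** Around each time the path stays in the union of a compact neighbourhood of its value and one of
    its left limit; compactness of [[0, t]] leaves finitely many such pieces. *)
Lemma cadlag_compact_range x t : locally_compact [set: E] -> cadlag x ->
  exists2 K : set E, compact K & forall s, 0 <= s <= t -> K (x s).
Proof.
move=> lc cx.
(* A property holds along [F] when it holds for all sets containing some compact set. The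
   near-covering form of compactness then yields one set valid for all times. *)
pose F : set_system (set E) :=
  filter_from [set K | compact K] (fun K => [set K' | K `<=` K']).
have FF : Filter F.
  apply: filter_from_filter; first by exists set0; exact: compact0.
  move=> K K' cK cK'; exists (K `|` K'); first exact: compactU.
  by move=> K''; rewrite /= subUset.
have nearK (z : E) : exists2 K, compact K & nbhs z K.
  have [K zK [cK _]] := lc z I; exists K => //.
  by move: zK; rewrite /within/=; apply: (@filterS _ (nbhs z)) => s Ks; exact: Ks I.
have := (compact_near_coveringP _).1 (@segment_compact R 0 t).
move=> /near_covering_withinP /(_ _ F (fun K s => K (x s)) FF)[|K cK Kx]; last first.
  by exists K => // s st; apply: (Kx K) => //; rewrite /= in_itv.
move=> s; rewrite /= in_itv/= => /andP[s0 st].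
have [K1 cK1 sK1] := nearK (x s).
have [rx lx] := cx s s0.
have near1 : \forall s' \near s^'+, K1 (x s') by exact: rx.
have [K2 cK2 near2] : exists2 K2 : set E, compact K2 &
    \forall s' \near s^'-, 0 <= s' -> K2 (x s').
  move: s0; rewrite le_eqVlt => /predU1P[<-|s0].
    exists set0; first exact: compact0.
    near=> s' => s'0; have : s' < 0 by near: s'; exact: nbhs_left_lt.
    by rewrite ltNge s'0.
  have [l xl] := lx s0; have [K2 cK2 lK2] := nearK l.
  exists K2 => //; have : \forall s' \near s^'-, K2 (x s') by exact: xl.
  by apply: filterS.
pose K := K1 `|` K2.
have cK : compact K by exact: compactU.
exists ((fun s' => 0 <= s' -> K (x s')), [set K' | K `<=` K']).
  split; last by exists K.
  move: near1 near2; rewrite /at_right /at_left !near_withinE => near1 near2.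
  suff : \forall s' \near s, 0 <= s' -> K (x s') by [].
  apply: filterS2 near1 near2 => s' r1 r2 s'0.
  have [ss'|ss'|ss'] := ltgtP s s'; [by left; exact: r1|by right; exact: r2|].
  by left; rewrite -ss'; exact: nbhs_singleton sK1.
by move=> [s' K'] [/= s'K KK'] s'0; apply: KK'; apply: s'K; case/andP: s'0.
Unshelve. all: by end_near. Qed.

End cadlag_paths.

Section lamperti.
Context {R : realType} {E : metricType R} (h : E -> R).
Implicit Types x : R -> E.

Definition rate x s : R := (h (x s))^-1.

Definition lamperti x (t : R) : one_point_compactification E :=
  if (t%:E < clock (rate x) +oo)%E then Some (x (clock_inv (rate x) t))
  else None.

Hypothesis lcE : locally_compact [set: E].
Hypothesis h0 : forall z, 0 < h z.
Hypothesis ch : continuous h.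

Lemma compact_rate_bounded (K : set E) : compact K ->
  exists M, forall z, K z -> (h z)^-1 <= M.
Proof.
move=> cK.
have /compact_bounded[M [_ MK]] : compact ((fun z => (h z)^-1) @` K).
  apply: continuous_compact => //; apply: continuous_subspaceT => z.
  by apply: cvgV; [rewrite gt_eqF|exact: ch].
exists (M + 1) => z Kz; apply: le_trans (ler_norm _) _.
by apply: (MK (M + 1)); [rewrite ltrDl|exists z].
Qed.

Lemma measurable_rate x : cadlag x ->
  measurable_fun (`[0, +oo[%classic : set R) (rate x).
Proof.
move=> cx.
(* The path is seen as a process over the time axis itself, constant in its random argument and
   sampled at the time [Num.max s 0]. *)
have mx : borel_fun (fun s : measurableTypeR R => x (Num.max s 0)).
  apply: (@borel_fun_random_time _ _ _ _ (fun s _ => x s)).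
  - by move=> s _; exact: borel_fun_cst.
  - by move=> _ s /cx[].
  - exact: measurable_maxr.
  - by move=> s; rewrite le_max lexx orbT.
apply: (@eq_measurable_fun _ _ _ _ (`[0, +oo[%classic : set R)
  (fun s => (h (x (Num.max s 0)))^-1)).
  by move=> s /set_mem; rewrite /= in_itv/= andbT => s0; rewrite max_l.
apply: measurable_funTS; apply: borel_fun_measurable.
apply: (@continuous_borel_fun _ _ _ _ (fun z => (h z)^-1) _ _ mx) => z.
by apply: cvgV; [rewrite gt_eqF|exact: ch].
Qed.

Lemma cadlag_clock_rate x : cadlag x -> clock_rate (rate x).
Proof.
move=> cx; split; first exact: measurable_rate.
  by move=> s _; rewrite invr_gt0.
move=> t; have [K cK Kx] := cadlag_compact_range t lcE cx.
have [M KM] := compact_rate_bounded cK; exists M => s st.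
exact/KM/Kx.
Qed.

(** The clock is additive, so the clock of the path restarted at [clock_inv s] is the old one minus
    [s]. This is the pathwise part of the Markov property. *)
Lemma lamperti_shift x s t : cadlag x -> 0 <= s -> 0 <= t ->
  (s%:E < clock (rate x) +oo)%E ->
  lamperti x (s + t) = lamperti (fun u => x (clock_inv (rate x) s + u)) t.
Proof.
move=> cx s0 t0 sy; have rg := cadlag_clock_rate cx.
set a := clock_inv (rate x) s; have a0 : 0 <= a by exact: (clock_inv_ge0 rg).
have cx' := cadlag_shift a0 cx; have rg' := cadlag_clock_rate cx'.
have shift (u : \bar R) : (0 <= u)%E ->
    clock (rate x) (a%:E + u)%E = (s%:E + clock (rate (fun u => x (a + u)%R)) u)%E.
  by move=> u0; rewrite clock_shift// clock_invK.
rewrite /lamperti -[X in clock (rate x) X](_ : a%:E + +oo = +oo)%E//.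
rewrite shift ?leey// EFinD lteD2lE//; case: ifPn => // ty.
have b0 : 0 <= clock_inv (rate (fun u => x (a + u))) t.
  exact: (clock_inv_ge0 rg').
congr (Some (x _)); apply: (clock_invE rg); first by rewrite addr_ge0.
by rewrite EFinD shift ?lee_fin// clock_invK.
Qed.

(** At the total clock the path is in the cemetery, so every compact set has been left. Conversely,
    up to time [u] the path [x] stays in one compact set, whose exit time is thus at least
    [clock u]. *)
Lemma lamperti_lifetime x : cadlag x ->
  lifetime (x 0) (lamperti x) = clock (rate x) +oo%E.
Proof.
move=> cx; have rg := cadlag_clock_rate cx.
apply/eqP; rewrite eq_le; apply/andP; split.
  apply: ge_ereal_sup => _ [K [cK _] <-].
  move: (clock_ge0 rg +oo%E).
  case gE : (clock (rate x) +oo%E) => [z| |]// z0; last by rewrite leey.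
  apply: ereal_inf_lbound; exists z => //=; split; first by rewrite -lee_fin.
  by rewrite /lamperti gE ltxx => -[].
have exceed r : (r%:E < clock (rate x) +oo)%E ->
    (r%:E < lifetime (x 0%R) (lamperti x))%E.
  move=> /(clock_exceeds rg)[u u0 ru]; apply: (lt_le_trans ru).
  have [K cK Kx] := cadlag_compact_range u lcE cx.
  apply: (@le_trans _ _ (exit_time K (lamperti x))).
    apply: le_ereal_inf_tmp => _ [s [s0 Ks] <-].
    rewrite leNgt; apply/negP => su; apply: Ks.
    have sy := clock_lty rg u0 su.
    rewrite /lamperti sy; exists (x (clock_inv (rate x) s)) => //.
    apply: Kx; rewrite (clock_inv_ge0 rg)//=.
    by rewrite ltW// (clock_inv_lt rg).
  apply: ereal_sup_ubound; exists K => //; split=> //.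
  by apply: Kx; rewrite lexx.
rewrite leNgt; apply/negP => Sx; move: Sx exceed.
case: (lifetime _ _) => [r||] Sx /=.
- by move=> /(_ _ Sx); rewrite ltxx.
- by move: Sx; rewrite ltNge leey.
(* The level -1 is below every clock, which rules out a supremum equal to [-oo]. *)
- have N1 : ((-1)%:E < clock (rate x) +oo)%E.
    by apply: lt_le_trans (clock_ge0 rg _); rewrite lte_fin ltrN10.
  by move=> /(_ _ N1); rewrite ltNge leNye.
Qed.

(* When the clock stops at a finite time, the only way to reach the cemetery
   continuously is that x leaves every compact set. *)
Lemma lamperti_lifetime_path x : cadlag x ->
  ((clock (rate x) +oo < +oo)%E ->
    forall K, compact K -> \forall s \near +oo, ~ K (x s)) ->
  lifetime_path (x 0) (lamperti x).
Proof.
move=> cx escape; have rg := cadlag_clock_rate cx.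
have y0 : (0%:E < clock (rate x) +oo)%E by apply: (clock_gt0 rg); exact: ltry.
pose z : R := fine (clock (rate x) +oo%E).
have SomeC : continuous (Some : E -> one_point_compactification E).
  exact: one_point_compactification_some_continuous.
have dead t : (clock (rate x) +oo <= t%:E)%E -> lamperti x t = None.
  by rewrite /lamperti leNgt => /negbTE ->.
have left_z : (clock (rate x) +oo < +oo)%E ->
    lamperti x s @[s --> z^'-] --> (None : one_point_compactification E).
  move=> gy A [K [cK _] KA].
  have gfin : clock (rate x) +oo%E \is a fin_num.
    by rewrite ge0_fin_numE ?(clock_ge0 rg).
  have Kinv : \forall s \near z^'-, ~ K (x (clock_inv (rate x) s)).
    exact: (clock_inv_lifetime rg gy (escape gy K cK)).
  suff : \forall s \near z^'-, A (lamperti x s) by [].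
  near=> s; apply: KA; left.
  have sz : (s%:E < clock (rate x) +oo)%E.
    by rewrite -(fineK gfin) lte_fin; near: s; exact: nbhs_left_lt.
  rewrite /lamperti sz; exists (x (clock_inv (rate x) s)) => //.
  by near: s.
split.
- rewrite /lamperti y0; congr (Some (x _)).
  by apply: (clock_invE rg) => //; exact: clock0.
- move=> t t0; have [ty|ty] := ltP t%:E (clock (rate x) +oo)%E; last first.
    split.
      rewrite dead//; apply: cvg_near_cst; near=> s; apply: dead.
      rewrite (le_trans ty)// lee_fin; near: s; exact: nbhs_right_ge.
    move=> t1; move: ty; rewrite le_eqVlt => /predU1P[ty|ty].
      exists None; have -> : t = z by rewrite /z ty.
      by apply: left_z; rewrite ty ltry.
    exists None; apply: cvg_near_cst.
    have gfin : clock (rate x) +oo%E \is a fin_num.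
      by rewrite ge0_fin_numE ?(clock_ge0 rg)// (lt_trans ty)// ltry.
    near=> s; apply: dead; rewrite -(fineK gfin) lee_fin; near: s.
    by apply: nbhs_left_ge; rewrite -lte_fin fineK.
  have [v v0 tv] := clock_exceeds rg ty.
  have alive : \forall s \near t, 0 <= s -> (s%:E < clock (rate x) +oo)%E.
    have : t < fine (clock (rate x) v%:E).
      by rewrite -lte_fin (fineK (clock_fin rg _)).
    move=> /lt_nbhsl; apply: filterS => s sv _; apply: (clock_lty rg v0).
    by rewrite -(fineK (clock_fin rg _)) lte_fin.
  have i0 := clock_inv_ge0 rg t0 ty.
  have [rx lx] := cx _ i0; split.
    rewrite {2}/lamperti ty; apply: (@cvg_trans _ (Some (x (clock_inv (rate x) s)) @[s --> t^'+])).
      apply: near_eq_cvg; near=> s; rewrite /lamperti ifT//.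
      have s0 : 0 <= s by rewrite (le_trans t0)//; near: s; exact: nbhs_right_ge.
      by move: s0; near: s; exact: cvg_within.
    apply: (cvg_comp _ _ (cvg_comp _ _ (clock_inv_right rg t0 ty) rx)).
    exact: SomeC.
  move=> t1; have [|l xl] := lx _.
    by rewrite (clock_inv_gt rg)// clock0 lte_fin.
  exists (Some l).
  apply: (@cvg_trans _ (Some (x (clock_inv (rate x) s)) @[s --> t^'-])).
    apply: near_eq_cvg; near=> s; rewrite /lamperti ifT//.
    have s0 : 0 <= s by near: s; exact: nbhs_left_ge.
    by move: s0; near: s; exact: cvg_within.
  apply: (cvg_comp _ _ (cvg_comp _ _ (clock_inv_left rg t1 ty) xl)).
  exact: SomeC.
- by rewrite lamperti_lifetime.
- rewrite lamperti_lifetime// => gy; split; first exact: left_z.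
  exact: dead.
Unshelve. all: by end_near. Qed.

End lamperti.

(** * Measurability and adaptedness of the time change *)

Section lamperti_measurable.
Context {R : realType} {E : metricType R} (h : E -> R).
Hypothesis lcE : locally_compact [set: E].
Hypothesis h0 : forall z, 0 < h z.
Hypothesis ch : continuous h.

Section joint.
Context {d} {W : measurableType d} (V : R -> W -> E).
Hypothesis mV : forall s, 0 <= s -> borel_fun (V s).
Hypothesis cV : forall w, cadlag (V ^~ w).

Let rg w : clock_rate (rate h (V ^~ w)) := cadlag_clock_rate lcE h0 ch (cV w).

(** The clock is a partial integral of a jointly measurable function, so Tonelli's theorem applies;
    [Num.max] and the indicator extend the integrand to all real times. *)
Lemma measurable_clock (t : \bar R) :
  measurable_fun setT (fun w => clock (rate h (V ^~ w)) t).
Proof.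
pose D := [set s : R | 0 <= s /\ (s%:E <= t)%E].
pose f (p : W * measurableTypeR R) : \bar R :=
  (rate h (V ^~ p.1) (Num.max p.2 0) * \1_D p.2)%:E.
have mf : measurable_fun setT f.
  apply/measurable_EFinP; apply: measurable_funM; last first.
    apply: (measurableT_comp (f := \1_D : measurableTypeR R -> R)) => //.
    by apply: measurable_indic; exact: measurable_clock_dom.
  apply: (@measurableT_comp _ _ _ _ _ _
    (fun q : measurableTypeR R * W => rate h (V ^~ q.2) (Num.max q.1 0)) setT
    (fun p : W * measurableTypeR R => (p.2, p.1))); last first.
    by apply: measurable_fun_pair.
  apply: borel_fun_measurable.
  apply: (@continuous_borel_fun _ _ _ _ (fun z => (h z)^-1) _ _
    (borel_fun_jointly mV (fun w s s0 => (cV w s0).1))) => z.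
  by apply: cvgV; [rewrite gt_eqF|exact: ch].
have f0 p : (0 <= f p)%E.
  by rewrite lee_fin mulr_ge0// invr_ge0 ltW.
rewrite (_ : (fun w => _) = fubini_F (@lebesgue_measure R) f); last first.
  apply/funext => w; rewrite /clock /fubini_F [LHS]integral_mkcond.
  apply: eq_integral => s _; rewrite patchE /f indicE -/D; case: ifPn => [sD|].
    by rewrite mulr1 max_l//; case/set_mem: sD.
  by rewrite mulr0.
exact: measurable_fun_fubini_tonelli_F.
Qed.

Lemma measurable_clock_gt (t : R) (u : \bar R) :
  measurable [set w | (t%:E < clock (rate h (V ^~ w)) u)%E].
Proof.
rewrite -[X in measurable X]setTI.
by apply: emeasurable_fun_o_infty => //; exact: measurable_clock.
Qed.

Lemma measurable_clock_inv (t : R) : 0 <= t -> measurable_fun setT (fun w =>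
  if (t%:E < clock (rate h (V ^~ w)) +oo)%E then clock_inv (rate h (V ^~ w)) t
  else 0).
Proof.
move=> t0; apply: measurable_lt_real => x; have [x0|x0] := leP x 0.
  rewrite (_ : [set _ | _] = set0)//; apply/seteqP; split=> // w /=.
  case: ifPn => [ty|_]; last by rewrite ltNge x0.
  by rewrite ltNge (le_trans x0)// (clock_inv_ge0 (rg w)).
rewrite (_ : [set _ | _] = [set w | (t%:E < clock (rate h (V ^~ w)) x%:E)%E] `|`
    ~` [set w | (t%:E < clock (rate h (V ^~ w)) +oo)%E]).
  by apply: measurableU; [|apply: measurableC]; exact: measurable_clock_gt.
apply/seteqP; split=> w /=.
  case: ifPn => [ty|/negP ty _]; last by right.
  by rewrite (clock_inv_lt (rg w) t0 ty (ltW x0)) => tx; left.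
move=> [tx|/negP ty]; last by rewrite (negbTE ty).
have ty := clock_lty (rg w) (ltW x0) tx.
by rewrite ty (clock_inv_lt (rg w) t0 ty (ltW x0)).
Qed.

Lemma lamperti_borel_fun t : 0 <= t -> borel_fun (fun w => lamperti h (V ^~ w) t).
Proof.
move=> t0 B mB.
pose alive := [set w | (t%:E < clock (rate h (V ^~ w)) +oo)%E].
have ma : measurable alive by exact: measurable_clock_gt.
pose theta w := if (t%:E < clock (rate h (V ^~ w)) +oo)%E
  then clock_inv (rate h (V ^~ w)) t else 0.
have theta0 w : 0 <= theta w.
  by rewrite /theta; case: ifPn => // ty; exact: (clock_inv_ge0 (rg w)).
have mVt : borel_fun (fun w => V (theta w) w).
  apply: borel_fun_random_time => //; last exact: measurable_clock_inv.
  by move=> w s s0; exact: (cV w s0).1.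
have mSB : borel (Some @^-1` B : set E).
  apply: (continuous_borel _ mB).
  exact: one_point_compactification_some_continuous.
rewrite (_ : _ @^-1` B =
   (alive `&` (fun w => V (theta w) w) @^-1` (Some @^-1` B)) `|`
   (~` alive `&` [set _ | B None])).
  apply: measurableU; apply: measurableI => //; first exact: mVt.
    exact: measurableC.
  have [BN|BN] := pselect (B None).
    by rewrite (_ : [set _ | _] = setT)//; apply/seteqP; split.
  by rewrite (_ : [set _ | _] = set0)//; apply/seteqP; split.
apply/seteqP; split=> w; rewrite /lamperti /alive /theta /=.
  by case: ifPn => ty Bw; [left|right; split => //; exact/negP].
by move=> [[ty]|[/negP/negbTE ty]]; rewrite ty.
Qed.

End joint.

(** Where the clock at [u] exceeds [t], the time-changed path up to [t] is the one built from [V]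
    stopped at [u], so the event reads the past of [V] up to [u] only. *)
Lemma natural_filtration_lamperti {d} {Omega : measurableType d} (V : R -> Omega -> E)
    (t u : R) A : (forall w, cadlag (V ^~ w)) -> 0 <= t -> 0 <= u ->
  natural_filtration (fun s w => lamperti h (V ^~ w) s) t A ->
  natural_filtration V u (A `&` [set w | (t%:E < clock (rate h (V ^~ w)) u%:E)%E]).
Proof.
move=> cV t0 u0.
(* [W] is [Omega] equipped with the past of [V] up to [u]: measurable over [W] means adapted. *)
pose W : measurableType _ := g_sigma_algebraType
  [set A | exists s B, [/\ 0 <= s, s <= u, borel B & A = V s @^-1` B]].
pose V' s (w : W) := V (Num.min s u) w.
have mV' s : 0 <= s -> borel_fun (V' s).
  move=> s0 B mB; apply: sub_sigma_algebra.
  by exists (Num.min s u), B; split=> //; rewrite ?le_min ?s0// ge_min lexx orbT.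
have cV' w : cadlag (V' ^~ w) by exact: (@cadlag_stop _ _ (V ^~ w)).
have rgV w := cadlag_clock_rate lcE h0 ch (cV w).
have rgV' w := cadlag_clock_rate lcE h0 ch (cV' w).
have clockE w v : v <= u ->
    clock (rate h (V' ^~ w)) v%:E = clock (rate h (V ^~ w)) v%:E.
  move=> vu; apply: eq_clock => s s0 sv; rewrite /rate /V' min_l//.
  by rewrite (le_trans _ vu)// -lee_fin.
set S := [set w | _].
have SE : S = [set w | (t%:E < clock (rate h (V' ^~ w)) u%:E)%E].
  by apply/seteqP; split=> w; rewrite /S/= clockE.
have mS : natural_filtration V u S.
  by rewrite SE; exact: (measurable_clock_gt mV' cV').
apply: (sigma_algebra_sub (H := [set A | natural_filtration V u (A `&` S)])).
- by rewrite /= setTI.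
- move=> A0 /= mA; rewrite (_ : _ `&` _ = S `\` (A0 `&` S)).
    exact: (@measurableD _ W).
  by rewrite setDIr setDv setU0 setDE setIC.
- move=> F /= mF; rewrite setI_bigcupl.
  exact: (@bigcupT_measurable _ W).
- move=> _ [s [B [s0 st mB ->]]] /=.
  rewrite (_ : _ `&` _ = (fun w => lamperti h (V' ^~ w) s) @^-1` B `&` S).
    apply: (@measurableI _ W) => //.
    exact: (lamperti_borel_fun mV' cV' s0).
  suff lE w : S w -> lamperti h (V ^~ w) s = lamperti h (V' ^~ w) s.
    by apply/seteqP; split=> w /= [Bw Sw]; split=> //; [rewrite -lE|rewrite lE].
  rewrite /S/= => tu.
  have su : (s%:E < clock (rate h (V ^~ w)) u%:E)%E.
    by apply: le_lt_trans tu; rewrite lee_fin.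
  have sy := clock_lty (rgV w) u0 su.
  have su' : (s%:E < clock (rate h (V' ^~ w)) u%:E)%E by rewrite clockE.
  have vu : clock_inv (rate h (V ^~ w)) s <= u.
    by rewrite ltW// (clock_inv_lt (rgV w)).
  have v0 := clock_inv_ge0 (rgV w) s0 sy.
  rewrite /lamperti sy (clock_lty (rgV' w) u0 su').
  rewrite (clock_invE (rgV' w) v0 (_ : _ = s%:E)); last first.
    by rewrite clockE// (clock_invK (rgV w)).
  by rewrite /V' min_l.
Qed.

End lamperti_measurable.

(** * Strong Markov property of Levy processes *)

Lemma sigma_algebra_setI {T : Type} (G : set (set T)) A B :
  <<s G >> A -> <<s G >> B -> <<s G >> (A `&` B).
Proof.
move=> GA GB; rewrite -[_ `&` _]setCK setCI; apply: sigma_algebra_setC.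
rewrite -bigcup2E; have [G0 _ GU] := smallest_sigma_algebra [set: T] G.
by apply: GU => -[|[|n]] //=; exact: sigma_algebra_setC.
Qed.

(** * Path events and their approximation *)

Section path_measurable.
Context {R : realType} {T : topologicalType}.
Implicit Types C : set (R -> T).

Lemma path_measurable_preimage {d} {W : measurableType d} (Y : R -> W -> T) C :
  (forall s, 0 <= s -> borel_fun (Y s)) -> path_measurable C ->
  measurable [set w | C (fun s => Y s w)].
Proof.
move=> mY; apply: (@sub_sigma_algebra_preimage _ _ (fun w s => Y s w)).
  exact: sigma_algebra_measurable.
by move=> _ [t [B [t0 mB ->]]]; exact: mY.
Qed.

(** Path events only test nonnegative times, so identities between paths need to be proved there
    only. *)
Lemma path_measurable_ext C (x x' : R -> T) : path_measurable C ->
  (forall s, 0 <= s -> x s = x' s) -> C x -> C x'.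
Proof.
move=> mC xx'; suff [] : C x <-> C x' by [].
move: C mC; apply: sigma_algebra_sub => //.
- by move=> C CC; split=> nC ?; apply: nC; exact/CC.
- by move=> F FF; split=> -[n _ Fn]; exists n => //; apply/FF.
- by move=> _ [t [B [t0 _ ->]]] /=; rewrite xx'.
Qed.

(* C is an increasing union of sets C_k such that a sequence of paths converging
   pointwise to a path of C is eventually in some C_k, while a sequence that is
   infinitely often in some C_k can only converge to paths of C. *)
Definition approximable C := exists Ck : nat -> set (R -> T),
  [/\ forall k, path_measurable (Ck k),
      forall k l, (k <= l)%N -> Ck k `<=` Ck l,
      forall (u : nat -> R -> T) x,
        (forall s, 0 <= s -> u n s @[n --> \oo] --> x s) -> C x ->
        exists k, \forall n \near \oo, Ck k (u n) &
      forall (u : nat -> R -> T) x k,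
        (forall s, 0 <= s -> u n s @[n --> \oo] --> x s) ->
        (forall N, exists2 n, (N <= n)%N & Ck k (u n)) -> C x].

Lemma approximableI : setI_closed approximable.
Proof.
move=> C C' [Ck [mCk ndC inC outC]] [Dk [mDk ndD inD outD]].
exists (fun k => Ck k `&` Dk k); split.
- by move=> k; exact: (sigma_algebra_setI (mCk k) (mDk k)).
- by move=> k l kl; apply: setISS; [exact: ndC|exact: ndD].
- move=> u x ux [/(inC _ _ ux)[k Hk] /(inD _ _ ux)[l Hl]].
  exists (maxn k l); apply: filterS2 Hk Hl => n uk ul; split.
    exact: (ndC _ _ (leq_maxl k l)).
  exact: (ndD _ _ (leq_maxr k l)).
- move=> u x k ux uk; split.
    by apply: (outC _ _ k ux) => N; have [n Nn []] := uk N; exists n.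
  by apply: (outD _ _ k ux) => N; have [n Nn []] := uk N; exists n.
Qed.

End path_measurable.

(** Open conditions on one coordinate are approximable by means of [shrink], and they generate all
    path events. *)
Lemma path_measurable_approximable {R : realType} {T : pseudoMetricType R} :
  @path_measurable R T `<=` <<s @approximable R T >>.
Proof.
apply: smallest_sub; first exact: smallest_sigma_algebra.
move=> _ [t [B [t0 mB ->]]].
apply: (@sub_sigma_algebra_preimage _ _ (fun x : R -> T => x t) _ _ _ _ _ mB).
  exact: smallest_sigma_algebra.
move=> O oO; apply: sub_sigma_algebra.
exists (fun k => [set x | shrink O k (x t)]); split.
- by move=> k; apply: sub_sigma_algebra; exists t, (shrink O k); split=> //;
    exact: shrink_borel.
- by move=> k l kl x; exact: shrink_nd.
- by move=> u x ux Ox; exact: (open_cvg_shrink oO (ux t t0)).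
- by move=> u x k ux uk; exact: (shrink_limit (ux t t0) uk).
Qed.

Section levy_strong_markov.
Context {R : realType} {E : metricType R}.
Variables (mul : E -> E -> E) (inv : E -> E) (e0 : E).
Context {d : measure_display} {Omega : measurableType d}.
Variables (P : probability Omega R) (L : R -> Omega -> E).
Hypothesis hE : topological_group mul inv e0.
Hypothesis sepE : Defs.separable E.
Hypothesis hL : levy_process P mul inv e0 L.

Let cmul : continuous (fun p : E * E => mul p.1 p.2).
Proof. by case: hE => _ []. Qed.

Let cinv : continuous inv.
Proof. by case: hE => _ []. Qed.

Let cincr : continuous (fun p : E * E => mul (inv p.1) p.2).
Proof.
move=> p; apply: (@continuous_comp _ _ _ (fun p : E * E => (inv p.1, p.2))
  (fun p : E * E => mul p.1 p.2)); last exact: cmul.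
apply: cvg_pair => /=; last exact: cvg_snd.
by apply: continuous_comp; [exact: cvg_fst|exact: cinv].
Qed.

Lemma natural_filtration_measurable t A : natural_filtration L t A -> measurable A.
Proof.
apply: smallest_sub; first exact: sigma_algebra_measurable.
by move=> _ [s [B [s0 _ mB ->]]]; exact: (levy_measurable hL).
Qed.

Lemma natural_filtration_le s t A : s <= t ->
  natural_filtration L s A -> natural_filtration L t A.
Proof.
move=> st; apply: sub_sigma_algebra2 => _ [r [B [r0 rs mB ->]]].
by exists r, B; split=> //; exact: le_trans rs st.
Qed.

Variable tau : Omega -> R.
Hypothesis tau0 : forall w, 0 <= tau w.
Hypothesis mtau : measurable_fun setT tau.

Definition post (T : Omega -> R) (s : R) (w : Omega) : E :=
  increment mul inv L (T w) s w.

Lemma borel_fun_post (T : Omega -> R) s : (forall w, 0 <= T w) ->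
  measurable_fun setT T -> 0 <= s -> borel_fun (post T s).
Proof.
move=> T0 mT s0.
have mY (th : Omega -> R) : (forall w, 0 <= th w) -> measurable_fun setT th ->
    borel_fun (fun w => L (th w) w).
  move=> th0 mth; apply: borel_fun_random_time => //.
    by move=> r r0 B mB; exact: (levy_measurable hL).
  by move=> w r r0; exact: (levy_cadlag hL w r0).1.
apply: (continuous_borel_fun cincr (f := fun w => (L (T w) w, L (T w + s) w))).
apply: borel_fun_pair => //; first exact: mY.
apply: mY; first by move=> w; rewrite addr_ge0.
exact: measurable_funD.
Qed.

Lemma cadlag_post (T : Omega -> R) w : 0 <= T w -> cadlag (post T ^~ w).
Proof.
move=> T0; pose f z := mul (inv (L (T w) w)) z.
have cf : continuous f.
  move=> z; apply: (@continuous_comp _ _ _ (fun z => (L (T w) w, z))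
    (fun p : E * E => mul (inv p.1) p.2)); last exact: cincr.
  by apply: cvg_pair => //=; exact: cvg_cst.
exact: (cadlag_continuous cf (cadlag_shift T0 (levy_cadlag hL w))).
Qed.

Let T n w := grid_above n (tau w).

Let T_ge0 n w : 0 <= T n w.
Proof. by rewrite ltW// (le_lt_trans (tau0 w))// grid_above_gt. Qed.

Let post_cvg w s : 0 <= s -> post (T n) s w @[n --> \oo] --> post tau s w.
Proof.
move=> s0.
have c := @cincr (L (tau w) w, L (tau w + s) w).
have g : (L (T n w) w, L (T n w + s) w) @[n --> \oo] -->
    (L (tau w) w, L (tau w + s) w).
  apply: cvg_pair => /=.
    exact: (cvg_comp _ _ (grid_above_cvg (tau0 w)) (levy_cadlag hL w (tau0 w)).1).
  have cs := (cadlag_shift s0 (levy_cadlag hL w) (tau0 w)).1.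
  have := cvg_comp _ _ (grid_above_cvg (tau0 w)) cs.
  by rewrite addrC; under eq_fun do rewrite addrC.
exact: (cvg_comp _ _ g c).
Qed.

(** The next hypothesis says at once that [tau] is an optional time on [A] and that [A] belongs to
    the past of [tau]. Outside [A] the time [tau] is merely measurable and nonnegative, which leaves
    room for a default value. *)
Variable A : set Omega.
Hypothesis adapted : forall u, 0 < u ->
  natural_filtration L u (A `&` [set w | tau w < u]).

Let mA : measurable A.
Proof.
rewrite (_ : A = \bigcup_(n : nat) (A `&` [set w | tau w < n.+1%:R])).
  apply: bigcupT_measurable => n; apply: natural_filtration_measurable.
  exact: adapted.
apply/seteqP; split=> w; last by move=> [n _ []].
by move=> Aw; exists (Num.truncn (tau w)) => //; split=> //=; exact: truncnS_gt.
Qed.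

Let mpost C (T' : Omega -> R) : (forall w, 0 <= T' w) ->
  measurable_fun setT T' -> path_measurable C ->
  measurable [set w | C (fun s => post T' s w)].
Proof.
move=> T0 mT; apply: path_measurable_preimage => s s0.
exact: borel_fun_post.
Qed.

Let mT n : measurable_fun setT (T n).
Proof.
apply: (measurableT_comp (f := grid_above n)) => //.
apply: nondecreasing_measurable; first exact: measurableT.
move=> s t st.
by rewrite ler_pM2r ?invr_gt0// ler_nat ltnS le_truncn// ler_wpM2l.
Qed.

Let levyP C t : 0 <= t -> path_measurable C ->
  P [set w | C (fun s => increment mul inv L t s w)] = law P L C.
Proof. by move=> t0 mC; exact: (levy_stationary hL). Qed.

Let lawfin C : path_measurable C -> law P L C \is a fin_num.
Proof.
move=> mC; apply: fin_num_measure.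
by apply: path_measurable_preimage => // s s0 B mB; exact: (levy_measurable hL).
Qed.

(** On each event [T n = t k] the time is deterministic, so independence and stationarity of
    increments apply; these events partition [A]. *)
Let discrete n C : path_measurable C ->
  P (A `&` [set w | C (fun s => post (T n) s w)]) = (P A * law P L C)%E.
Proof.
move=> mC.
pose t k : R := k.+1%:R / n.+1%:R.
pose I k : set Omega := A `&` [set w | T n w = t k].
have t0 k : 0 <= t k by rewrite divr_ge0.
have IF k : natural_filtration L (t k) (I k).
  (* [T n = t k] means that [tau] lies in a cell closed on the left and open on the right, a
     difference of two events [tau < u] with [u <= t k]. For [k = 0] the second one is empty, as
     [adapted] speaks of positive times only. *)
  rewrite (_ : I k = (A `&` [set w | tau w < t k]) `&`
      ~` (A `&` [set w | tau w < k%:R / n.+1%:R])).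
    apply: sigma_algebra_setI; first by apply: adapted; rewrite divr_gt0.
    apply: sigma_algebra_setC; case: k => [|k].
      rewrite (_ : _ `&` _ = set0); first by
        rewrite -setCT; apply: sigma_algebra_setC; exact: sigma_algebra_setT.
      by apply/seteqP; split=> // w [_ /=]; rewrite mul0r ltNge tau0.
    apply: (@natural_filtration_le (t k)); last by apply: adapted; rewrite divr_gt0.
    by rewrite /t ler_pM2r ?invr_gt0// ler_nat.
  have tE w : (T n w == t k) = (k%:R / n.+1%:R <= tau w < t k).
    exact: grid_above_eq.
  apply/seteqP; split=> w /=.
    move=> [Aw /eqP]; rewrite tE => /andP[k1 k2]; split=> // -[_].
    by rewrite ltNge k1.
  move=> [[Aw k2] k1]; split=> //; apply/eqP; rewrite tE k2 andbT leNgt.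
  by apply/negP => k3; apply: k1.
have mI k : measurable (I k) := natural_filtration_measurable (IF k).
have AE : A = \bigcup_k I k.
  apply/seteqP; split=> w; last by move=> [k _ []].
  by move=> Aw; exists (Num.truncn (n.+1%:R * tau w)).
have tI : trivIset setT I.
  move=> i j _ _ [w [[_ /= Ti] [_ /= Tj]]]; move: Ti => /eqP; rewrite Tj.
  by rewrite eqr_div// (inj_eq (mulIf _))// eqr_nat eqSS => /eqP.
pose Cp k : set Omega := [set w | C (fun s => increment mul inv L (t k) s w)].
have mCp k : measurable (Cp k) by exact: (mpost (T' := fun=> t k)).
rewrite (_ : _ `&` _ = \bigcup_k (I k `&` Cp k)); last first.
  apply/seteqP; split=> w /=.
    rewrite {1}AE => -[[k _ Ik] Cw]; exists k => //; split=> //.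
    by case: Ik => _ /= Tk; move: Cw; rewrite /post Tk.
  move=> [k _ [[Aw /= Tk]]] Cw; split=> //.
  by rewrite /post Tk.
rewrite [in RHS]AE !measure_bigcup//; last 2 first.
- by move=> k _; exact: measurableI.
- by move=> i j _ _ [w [[Ii _] [Ij _]]]; apply: tI => //; exists w.
rewrite muleC -(fineK (lawfin mC)) -nneseriesZl//.
apply: eq_eseriesr => k _; rewrite fineK ?lawfin// muleC.
transitivity (P (I k) * law P (increment mul inv L (t k)) C)%E.
  exact: (levy_indep hL (t0 k) (IF k) mC).
by congr (_ * _)%E; exact: levyP.
Qed.

(** For fixed [k] the probability of [B n k] is the same for all [n], so it lies between those of
    the lower and upper limits in [n]. The upper limits are contained in the target and the lower
    limits exhaust it as [k] grows, which closes the sandwich. *)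
Let limit C : approximable C ->
  P (A `&` [set w | C (fun s => post tau s w)]) = (P A * law P L C)%E.
Proof.
move=> [Ck [mCk ndC inC outC]].
pose B n k := A `&` [set w | Ck k (fun s => post (T n) s w)].
have mB n k : measurable (B n k) by apply: measurableI => //; apply: mpost => //; exact: mT.
pose q k := (P A * law P L (Ck k))%E.
have PB n k : P (B n k) = q k by exact: discrete.
have LC : \bigcup_k [set w | Ck k (L ^~ w)] = [set w | C (L ^~ w)].
  apply/seteqP; split=> w /=.
    move=> [k _ Ckw]; apply: (outC (fun=> L ^~ w) (L ^~ w) k) => [s _|N].
      exact: cvg_cst.
    by exists N.
  move=> /(inC (fun=> L ^~ w)) [s _|k [N _ /(_ N (leqnn _)) /= kw]].
    exact: cvg_cst.
  by exists k.
have mLC k : measurable [set w | Ck k (L ^~ w)].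
  apply: path_measurable_preimage => // s s0 B' mB'.
  exact: (levy_measurable hL).
have PAfin : P A \is a fin_num by exact: fin_num_measure.
have q_cvg : q k @[k --> \oo] --> (P A * law P L C)%E.
  apply: cvgeZl => //; rewrite /law -LC.
  apply: nondecreasing_cvg_mu => //; first exact: bigcupT_measurable.
  by move=> k l kl; apply/subsetPset => w /=; exact: ndC.
set target := A `&` _.
have mB_cap k N : measurable (\bigcap_(n in [set n | (N <= n)%N]) B n k).
  by apply: bigcap_measurable => [|n _ //]; exists N => /=.
have mB_cup k N : measurable (\bigcup_(n in [set n | (N <= n)%N]) B n k).
  exact: bigcup_measurable.
pose inf k := \bigcup_N \bigcap_(n in [set n | (N <= n)%N]) B n k.
pose sup k := \bigcap_N \bigcup_(n in [set n | (N <= n)%N]) B n k.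
have minf k : measurable (inf k) by exact: bigcupT_measurable.
have msup k : measurable (sup k) by exact: bigcapT_measurable.
have inf_target : \bigcup_k inf k = target.
  apply/seteqP; split=> w.
    move=> [k _ [N _ NB]]; split; first by have [] := NB N (leqnn _).
    apply: (outC (fun n => (post (T n)) ^~ w) _ k) => [s s0|N'].
      exact: post_cvg.
    exists (maxn N N'); first exact: leq_maxr.
    by have [] := NB (maxn N N') (leq_maxl _ _).
  move=> [Aw Cw].
  have [s s0|k [N _ NC]] := inC (fun n => (post (T n)) ^~ w) _ _ Cw.
    exact: post_cvg.
  by exists k => //; exists N => // n Nn; split=> //; exact: NC.
have sup_target k : sup k `<=` target.
  move=> w supw; split; first by have [n _ []] := supw 0%N I.
  apply: (outC (fun n => (post (T n)) ^~ w) _ k) => [s s0|N].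
    exact: post_cvg.
  by have [n Nn [_ Cn]] := supw N I; exists n.
have mtarget : measurable target.
  by rewrite -inf_target; exact: bigcupT_measurable.
have Pinf k : (P (inf k) <= q k)%E.
  have nd : {homo (fun N => \bigcap_(n in [set n | (N <= n)%N]) B n k) :
      m n / (m <= n)%N >-> (m <= n)%O}.
    move=> m n mn; apply/subsetPset => w mw r /= nr.
    by apply: mw; exact: leq_trans nr.
  apply: (cvge_le _ (nondecreasing_cvg_mu (mB_cap k) (minf k) nd)).
  apply: nearW => N /=; rewrite -(PB N k).
  apply: le_measure; rewrite ?inE//.
  by move=> w; apply; rewrite /= leqnn.
have Psup k : (q k <= P (sup k))%E.
  have ni : {homo (fun N => \bigcup_(n in [set n | (N <= n)%N]) B n k) :
      m n / (m <= n)%N >-> (n <= m)%O}.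
    move=> m n mn; apply/subsetPset => w [r /= nr Br].
    by exists r => //; exact: leq_trans nr.
  have fin0 : (P (\bigcup_(n in [set n | (0 <= n)%N]) B n k) < +oo)%E.
    by rewrite (le_lt_trans (probability_le1 _ _)) ?ltry.
  apply: (cvge_ge _ (nonincreasing_cvg_mu fin0 (mB_cup k) (msup k) ni)).
  apply: nearW => N /=; rewrite -(PB N k).
  apply: le_measure; rewrite ?inE//.
  by move=> w Bw; exists N => /=.
apply/eqP; rewrite eq_le; apply/andP; split; last first.
  apply: (cvge_le _ q_cvg); apply: nearW => k; apply: (le_trans (Psup k)).
  by apply: le_measure; rewrite ?inE.
have nd : {homo inf : m n / (m <= n)%N >-> (m <= n)%O}.
  move=> k l kl; apply/subsetPset => w [N _ NB]; exists N => // n Nn.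
  by have [Aw Cw] := NB n Nn; split=> //; exact: (ndC k l).
have mU : measurable (\bigcup_k inf k) by exact: bigcupT_measurable.
have cinf := nondecreasing_cvg_mu (mu := P) minf mU nd.
rewrite -inf_target -(cvg_lim (@ereal_hausdorff _) cinf).
rewrite -(cvg_lim (@ereal_hausdorff _) q_cvg).
apply: lee_lim; [exact: cvgP cinf|exact: cvgP q_cvg|].
by apply: nearW => k; exact: Pinf.
Qed.

(** The approximable sets form a pi-system that generates the path events, and the sets satisfying
    the product formula form a Dynkin system. *)
Lemma levy_strong_markov C : path_measurable C ->
  P (A `&` [set w | C (fun s => post tau s w)]) = (P A * law P L C)%E.
Proof.
pose H C := path_measurable C /\
  P (A `&` [set w | C (fun s => post tau s w)]) = (P A * law P L C)%E.
suff : @path_measurable R E `<=` H by move=> h /h[].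
have PAfin : P A \is a fin_num by exact: fin_num_measure.
have mL C' : path_measurable C' -> measurable [set w | C' (L ^~ w)].
  move=> mC; apply: path_measurable_preimage => // s s0 B mB.
  exact: (levy_measurable hL).
have dynH : dynkin H.
  split.
  - split; first exact: sigma_algebra_setT.
    by rewrite setIT /law probability_setT mule1.
  - move=> C' [mC PC]; split; first exact: sigma_algebra_setC.
    rewrite (_ : A `&` _ = A `\` [set w | C' (fun s => post tau s w)])//.
    rewrite measureD//; last 2 first.
    + exact: mpost.
    + by rewrite (le_lt_trans (probability_le1 _ _)) ?ltry.
    rewrite [law P L (~` _)](_ : _ = 1 - law P L C')%E; last first.
      by rewrite /law -probability_setC//; exact: mL.
    by rewrite muleBr ?fin_num_adde_defr// mule1; congr (_ - _)%E; exact: PC.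
  - move=> F tF HF; split.
      have [_ _] := smallest_sigma_algebra [set: R -> E]
        [set C | exists t B, [/\ 0 <= t, borel B & C = [set x : R -> E | B (x t)]]].
      by apply=> n; exact: (HF n).1.
    have mF n := (HF n).1.
    rewrite (_ : A `&` _ = \bigcup_n (A `&` [set w | F n (fun s => post tau s w)])); last first.
      by rewrite -setI_bigcupr; congr (_ `&` _); apply/seteqP; split.
    rewrite measure_bigcup//; last 2 first.
    + by move=> n _; apply: measurableI => //; exact: mpost.
    + by move=> i j _ _ [w [[_ Fi] [_ Fj]]]; apply: tF => //; exists (fun s => post tau s w).
    rewrite /law (_ : [set w | _] = \bigcup_n [set w | F n (L ^~ w)])//.
    rewrite measure_bigcup//; last 2 first.
    + by move=> n _; exact: mL.
    + by move=> i j _ _ [w [Fi Fj]]; apply: tF => //; exists (L ^~ w).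
    rewrite -(fineK PAfin) -nneseriesZl//.
    by apply: eq_eseriesr => n _; rewrite fineK//; exact: (HF n).2.
apply: subset_trans path_measurable_approximable _.
apply: lambda_system_subset => //; first exact: approximableI.
  exact/dynkin_lambda_system.
move=> C' aC; split; last exact: limit.
have [Ck [mCk _ inC outC]] := aC.
(* Approximation along constant sequences shows that an approximable set is the union of its [Ck],
   hence a path event. *)
have -> : C' = \bigcup_k Ck k.
  apply/seteqP; split=> x.
    move=> /(inC (fun=> x)) [s _|k [N _ /(_ N (leqnn _)) /= kx]].
      exact: cvg_cst.
    by exists k.
  move=> [k _ Ckx]; apply: (outC (fun=> x) x k) => [s _|N].
    exact: cvg_cst.
  by exists N.
have [_ _] := smallest_sigma_algebra [set: R -> E]
  [set C | exists t B, [/\ 0 <= t, borel B & C = [set x : R -> E | B (x t)]]].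
by apply.
Qed.

End levy_strong_markov.

(** * Freezing *)

(* Pointed copies of a topological space and of its space of cadlag paths, as
   required by the library's measurable types: the point e is a parameter. *)
Definition borel_space (T : topologicalType) (e : T) : Type := T.

Section borel_space.
Context (T : topologicalType) (e : T).

HB.instance Definition _ := Choice.on (borel_space e).
HB.instance Definition _ := isPointed.Build (borel_space e) e.
HB.instance Definition _ := @isMeasurable.Build (sigma_display (@open T))
  (borel_space e) (@borel T) (@sigma_algebra0 T setT open)
  (@sigma_algebra_setC T open) (@sigma_algebra_bigcup T setT open).

Lemma borel_fun_measurable_fun {d} {W : measurableType d} (f : W -> T) :
  borel_fun f -> measurable_fun setT (f : W -> borel_space e).
Proof. by move=> mf _ B mB; rewrite setTI; exact: mf. Qed.

Lemma measurable_fun_borel_fun {d} {W : measurableType d} (f : W -> T) :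
  measurable_fun setT (f : W -> borel_space e) -> borel_fun f.
Proof. by move=> mf B mB; rewrite -[X in measurable X]setTI; exact: mf. Qed.

End borel_space.

Record cadlag_path (R : realType) (T : topologicalType) (e : T) : Type :=
  CadlagPath { path_fun :> R -> T ; path_cadlag : cadlag path_fun }.

Arguments CadlagPath {R T} e path_fun path_cadlag.

Section cadlag_path.
Context (R : realType) (T : topologicalType) (e : T).
Local Notation D := (cadlag_path R e).

Lemma cadlag_cst : cadlag (fun _ : R => e).
Proof.
by move=> t _; split=> [|_]; [exact: cvg_cst|exists e; exact: cvg_cst].
Qed.

Definition coordinate_sets : set (set D) :=
  [set S | exists t B, [/\ 0 <= t, borel B & S = [set x : D | B (x t)]]].

HB.instance Definition _ := gen_eqMixin D.
HB.instance Definition _ := gen_choiceMixin D.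
HB.instance Definition _ := isPointed.Build D (CadlagPath e _ cadlag_cst).
HB.instance Definition _ := @isMeasurable.Build (sigma_display coordinate_sets)
  D (<<s coordinate_sets >>) (@sigma_algebra0 D setT coordinate_sets)
  (@sigma_algebra_setC D coordinate_sets)
  (@sigma_algebra_bigcup D setT coordinate_sets).

Lemma borel_fun_coordinate s : 0 <= s -> borel_fun (fun x : D => x s).
Proof. by move=> s0 B mB; apply: sub_sigma_algebra; exists s, B. Qed.

Lemma measurable_cadlag_path {d} {W : measurableType d} (Y : R -> W -> T)
    (cY : forall w, cadlag (Y ^~ w)) : (forall s, 0 <= s -> borel_fun (Y s)) ->
  measurable_fun setT (fun w => CadlagPath e (Y ^~ w) (cY w)).
Proof.
move=> mY _ S mS; rewrite setTI; move: S mS.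
apply: sub_sigma_algebra_preimage; first exact: sigma_algebra_measurable.
by move=> _ [t [B [t0 mB ->]]]; exact: mY.
Qed.

(** Leads from events on cadlag paths back to events on all functions, in terms of which laws and
    independence are stated. *)
Lemma measurable_path_trace (S : set D) : measurable S ->
  exists2 C : set (R -> T), path_measurable C & S = [set x : D | C x].
Proof.
move: S; apply: sigma_algebra_sub.
- by exists setT; [exact: sigma_algebra_setT|apply/seteqP; split].
- by move=> S [C mC ->]; exists (~` C); first exact: sigma_algebra_setC.
- move=> F FP.
  have /choice[C CP] : forall n, exists C : set (R -> T),
      path_measurable C /\ F n = [set x : D | C x].
    by move=> n; have [C mC FC] := FP n; exists C.
  exists (\bigcup_n C n).
    by apply: sigma_algebra_bigcup => n; exact: (CP n).1.
  by apply/seteqP; split=> x [n _ Fx]; exists n => //; move: Fx; rewrite (CP n).2.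
- move=> _ [t [B [t0 mB ->]]]; exists [set x : R -> T | B (x t)] => //.
  by apply: sub_sigma_algebra; exists t, B.
Qed.

End cadlag_path.

Section freezing.
Context {R : realType} {E : topologicalType} (e : E).
Context {d : measure_display} {Omega : measurableType d}.
Variables (P : probability Omega R) (L Y : R -> Omega -> E) (Z : Omega -> E).
Local Notation D := (cadlag_path R e).
Local Notation B := (borel_space e).
Variable A : set Omega.
Hypotheses (mA : measurable A) (mZ : borel_fun Z).
Hypotheses (mL : forall s, 0 <= s -> borel_fun (L s)).
Hypotheses (mY : forall s, 0 <= s -> borel_fun (Y s)).
Hypotheses (cL : forall w, cadlag (L ^~ w)) (cY : forall w, cadlag (Y ^~ w)).
Hypothesis indep : forall F C, borel F -> path_measurable C ->
  P (A `&` Z @^-1` F `&` [set w | C (Y ^~ w)]) = (P (A `&` Z @^-1` F) * law P L C)%E.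

Let pathL w : D := CadlagPath e (L ^~ w) (cL w).
Let pathY w : D := CadlagPath e (Y ^~ w) (cY w).

Let measurable_section (S : set (B * D)) z : measurable S ->
  measurable [set w | S (z, pathL w)].
Proof.
move=> mS; rewrite -[X in measurable X]setTI.
have mp : measurable_fun setT (fun w => (z, pathL w) : B * D).
  by apply: measurable_fun_pair => //; exact: measurable_cadlag_path.
exact: mp.
Qed.

Lemma measurable_frozen_law (S : set (B * D)) : measurable S ->
  measurable_fun setT (fun z : B => P [set w | S (z, pathL w)]).
Proof.
move=> mS; pose S' : set (B * Omega) := [set p | S (p.1, pathL p.2)].
have mS' : measurable S'.
  rewrite -[X in measurable X]setTI.
  have mp : measurable_fun setT (fun p : B * Omega => (p.1, pathL p.2) : B * D).
    apply: measurable_fun_pair => //.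
    by apply: (measurableT_comp (f := pathL)) => //; exact: measurable_cadlag_path.
  exact: mp.
have -> : (fun z : B => P [set w | S (z, pathL w)]) = P \o xsection S'.
  by apply/funext => z /=; congr (P _); apply/seteqP; split=> w; rewrite /xsection/= inE.
exact: measurable_fun_xsection.
Qed.

Let g (S : set (B * D)) w := P [set w' | S (Z w, pathL w')].

Let mg (S : set (B * D)) : measurable S -> measurable_fun A (g S).
Proof.
move=> mS; apply: measurable_funTS.
apply: (measurableT_comp (measurable_frozen_law mS)).
exact: borel_fun_measurable_fun.
Qed.

Let mZY (S : set (B * D)) : measurable S -> measurable [set w | S (Z w, pathY w)].
Proof.
move=> mS; rewrite -[X in measurable X]setTI.
have mp : measurable_fun setT (fun w => (Z w, pathY w) : B * D).
  apply: measurable_fun_pair; first exact: borel_fun_measurable_fun.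
  exact: measurable_cadlag_path.
exact: mp.
Qed.

Lemma freezing (S : set (B * D)) : measurable S ->
  P (A `&` [set w | S (Z w, pathY w)]) =
  (\int[P]_(w in A) P [set w' | S (Z w, pathL w')])%E.
Proof.
pose G := [set F `*` C | F in @measurable _ B & C in @measurable _ D].
have mE : @measurable _ (B * D)%type = <<s G >>.
  exact: measurable_prod_measurableType.
have g0 S' w : (0 <= g S' w)%E by exact: measure_ge0.
move=> mS; have : <<s G >> S by rewrite -mE.
move: {mS} S; apply: (dynkin_induction mE).
- move=> _ _ [F mF [C mC <-]] [F' mF' [C' mC' <-]].
  exists (F `&` F'); first exact: measurableI.
  exists (C `&` C'); first exact: measurableI.
  by rewrite setXI.
- rewrite (_ : [set w | _] = setT)// setIT.
  have -> : (\int[P]_(w in A) P [set w' | [set: B * D] (Z w, pathL w')] =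
      \int[P]_(w in A) 1)%E.
    by apply: eq_integral => w _; rewrite -(probability_setT P).
  by rewrite integral_cst// mul1e.
- move=> _ [F mF [C' mC' <-]].
  have [C mC ->] := measurable_path_trace mC'.
  rewrite (_ : A `&` _ = A `&` Z @^-1` F `&` [set w | C (Y ^~ w)]); last first.
    by apply/seteqP; split=> w /=; [move=> [? []]|move=> [[]]].
  rewrite indep//.
  have -> : (\int[P]_(w in A) P [set w' | (F `*` [set x : D | C x]) (Z w, pathL w')] =
      \int[P]_(w in A) (law P L C * (\1_(Z @^-1` F) w)%:E))%E.
    apply: eq_integral => w _; rewrite indicE.
    have [ZF|ZF] := boolP (w \in Z @^-1` F).
      by rewrite mule1; congr (P _); apply/seteqP; split=> w'; [case|split=> //; exact/set_mem].
    rewrite mule0 (_ : [set w' | _] = set0) ?measure0//.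
    by apply/seteqP; split=> // w' [/= Fw _]; move/negP: ZF; apply; rewrite inE.
  have mZF : measurable (Z @^-1` F) by exact: mZ.
  have -> : P (A `&` Z @^-1` F) = (\int[P]_(w in A) (\1_(Z @^-1` F) w)%:E)%E.
    by rewrite integral_indic// setIC.
  rewrite muleC; apply/esym/ge0_integralZl => //.
  by apply/measurable_EFinP; exact: measurable_indic.
- move=> S mS IH.
  have mgS := mg mS; have mgSC := mg (measurableC mS).
  have gC w : (g (~` S) w + g S w = 1)%E.
    rewrite /g (_ : [set w' | (~` S) _] = ~` [set w' | S (Z w, pathL w')])//.
    rewrite probability_setC ?subeK//; last exact: measurable_section.
    by apply: fin_num_measure; exact: measurable_section.
  have intgS : (\int[P]_(w in A) g S w)%E \is a fin_num.
    by rewrite -IH; apply: fin_num_measure; apply: measurableI => //; exact: mZY.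
  have : (\int[P]_(w in A) g (~` S) w + \int[P]_(w in A) g S w = P A)%E.
    rewrite -ge0_integralD//; under eq_integral do rewrite gC.
    by rewrite integral_cst// mul1e.
  have : (P (A `&` [set w | (~` S) (Z w, pathY w)]) +
      P (A `&` [set w | S (Z w, pathY w)]) = P A)%E.
    rewrite -measureU//; last 3 first.
    + by apply: measurableI => //; exact: (mZY (measurableC mS)).
    + by apply: measurableI => //; exact: mZY.
    + by apply/seteqP; split=> // w [[_ /= nS] [_ /=]].
    congr (P _); apply/seteqP; split=> w; first by move=> [] [].
    by move=> Aw; have [Sw|Sw] := pselect (S (Z w, pathY w)); [right|left].
  move=> H1 H2; rewrite -[LHS](addeK _ (_ : P (A `&` [set w | S (Z w, pathY w)]) \is a fin_num));
    last by rewrite IH.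
  by rewrite H1 -H2 IH addeK.
- move=> F mF tF IH.
  rewrite (_ : A `&` _ = \bigcup_n (A `&` [set w | F n (Z w, pathY w)])); last first.
    by rewrite -setI_bigcupr.
  rewrite measure_bigcup//; last 2 first.
  + by move=> n _; apply: measurableI => //; exact: mZY.
  + by move=> i j _ _ [w [[_ Fi] [_ Fj]]]; apply: tF => //; exists (Z w, pathY w).
  have -> : (\int[P]_(w in A) P [set w' | (\bigcup_n F n) (Z w, pathL w')] =
      \int[P]_(w in A) \sum_(n <oo) g (F n) w)%E.
    apply: eq_integral => w _.
    rewrite (_ : [set w' | _] = \bigcup_n [set w' | F n (Z w, pathL w')])//.
    rewrite measure_bigcup//.
    + by apply: eq_eseriesl => n; rewrite in_setT.
    + by move=> n _; exact: measurable_section.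
    + by move=> i j _ _ [w' [Fi Fj]]; apply: tF => //; exists (Z w, pathL w').
  rewrite integral_nneseries//; last by move=> n; exact: mg.
  transitivity (\sum_(0 <= n <oo | n \in [set: nat]) \int[P]_(w in A) g (F n) w)%E.
    by apply: eq_eseriesr => n _; exact: IH.
  by apply: eq_eseriesl => n; rewrite in_setT.
Qed.

End freezing.

(** * Escape to infinity *)

Lemma clock_scale {R : realType} (g : R -> R) (c : R) (t : \bar R) :
  clock_rate g -> 0 <= c -> clock (fun s => c * g s) t = (c%:E * clock g t)%E.
Proof.
move=> rg c0; rewrite /clock -ge0_integralZl//.
- exact: measurable_clock_dom.
- apply/measurable_EFinP; apply: measurable_funS (rate_measurable rg).
    exact: measurable_itv.
  by move=> s [s0 _]; rewrite /= in_itv/= s0.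
- by move=> s [s0 _]; rewrite lee_fin ltW// (rate_gt0 rg).
Qed.

Section escape.
Context {R : realType} {E : metricType R}.
Variables (mul : E -> E -> E) (inv : E -> E) (e0 : E) (h : E -> R).
Context {d : measure_display} {Omega : measurableType d}.
Variables (P : probability Omega R) (L : R -> Omega -> E).
Hypothesis hE : topological_group mul inv e0.
Hypothesis lcE : locally_compact [set: E].
Hypothesis sepE : Defs.separable E.
Hypothesis hh : positive_character mul h.
Hypothesis hL : levy_process P mul inv e0 L.

Let h0 z : 0 < h z. Proof. by case: hh. Qed.
Let hM x y : h (mul x y) = h x * h y. Proof. by case: hh. Qed.
Let ch : continuous h. Proof. by case: hh. Qed.

Let h1 : h e0 = 1.
Proof.
have [[_ lid _ _ _] _] := hE.
by apply: (mulfI (lt0r_neq0 (h0 e0))); rewrite mulr1 -hM lid.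
Qed.

Let hV z : h (inv z) = (h z)^-1.
Proof.
have [[_ _ _ linv _] _] := hE.
have := hM (inv z) z; rewrite linv h1 => H.
by apply: (mulIf (lt0r_neq0 (h0 z))); rewrite -H mulVf// gt_eqF.
Qed.

Let mL s : 0 <= s -> borel_fun (L s).
Proof. by move=> s0 B mB; exact: (levy_measurable hL). Qed.
Let cL w : cadlag (L ^~ w) := levy_cadlag hL w.
Let rg (x : R -> E) (cx : cadlag x) := cadlag_clock_rate lcE h0 ch cx.
Let total w := clock (rate h (L ^~ w)) +oo%E.

Section hitting.
Variables (N : nat) (b : R).

Definition dips_below : set Omega := [set w | exists2 s, N%:R <= s & h (L s w) < b].

Local Notation hit := dips_below.

Let times w : set R := [set s | N%:R <= s /\ h (L s w) < b].
Let tau w : R := if `[< hit w >] then inf (times w) else 0.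

Let has_inf_times w : hit w -> has_inf (times w).
Proof.
by move=> [s Ns hs]; split; [exists s|exists N%:R => r []].
Qed.

Let tau_ge w : hit w -> N%:R <= tau w.
Proof.
move=> hw; rewrite /tau asboolT//.
by apply: lb_le_inf => [|r []//]; have [] := has_inf_times hw.
Qed.

Let tau0 w : 0 <= tau w.
Proof.
have [hw|hw] := pselect (hit w); first by rewrite (le_trans _ (tau_ge hw)).
by rewrite /tau asboolF.
Qed.

(** The condition [h < b] is open, so by right continuity a dip lasts for a while and is seen at a
    rational time. This makes [tau < u] a countable union of events of the past. *)
Let tau_lt w u : hit w -> (tau w < u) <->
  exists k n : nat, [/\ N%:R <= k%:R / n.+1%:R :> R, k%:R / n.+1%:R < u &
    h (L (k%:R / n.+1%:R) w) < b].
Proof.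
move=> hw; rewrite /tau asboolT//; split.
  move=> /(inf_lt (has_inf_times hw).1)[s [Ns hs] su].
  have s0 : 0 <= s by rewrite (le_trans _ Ns).
  have near_s : \forall r \near s^'+, h (L r w) < b.
    have : h (L r w) @[r --> s^'+] --> h (L s w).
      by apply: (cvg_comp _ _ (cL w s0).1); exact: ch.
    by move=> c; exact: (c _ (lt_nbhsl hs)).
  have near_u : \forall r \near s^'+, r < u by exact: nbhs_right_lt.
  have [n _ /(_ n (leqnn _)) [/= hn un]] :=
    grid_above_cvg s0 (filterI near_s near_u).
  exists (Num.truncn (n.+1%:R * s)).+1, n; split=> //.
  by rewrite (le_trans Ns)// ltW// grid_above_gt.
move=> [k [n [Nk ku hk]]]; apply: le_lt_trans ku.
by apply: ge_inf; [have [] := has_inf_times hw|].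
Qed.

Let hitE (u : R) : hit `&` [set w | tau w < u] = \bigcup_k \bigcup_n
  [set w | [/\ N%:R <= k%:R / n.+1%:R :> R, k%:R / n.+1%:R < u &
    h (L (k%:R / n.+1%:R) w) < b]].
Proof.
apply/seteqP; split=> w.
  by move=> [hw /= /(tau_lt _ hw)[k [n knu]]]; exists k => //; exists n.
move=> [k _ [n _ [Nk ku hk]]].
have hw : hit w by exists (k%:R / n.+1%:R).
by split=> //; apply/(tau_lt _ hw); exists k, n.
Qed.

Let adapted u : 0 < u -> natural_filtration L u (hit `&` [set w | tau w < u]).
Proof.
move=> u0; rewrite hitE; apply: sigma_algebra_bigcup => k.
apply: sigma_algebra_bigcup => n.
have [Nk|Nk] := pselect (N%:R <= k%:R / n.+1%:R :> R); last first.
  rewrite [X in smallest _ _ X](_ : _ = set0); first exact: sigma_algebra0.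
  by apply/seteqP; split=> // w [].
have [ku|ku] := pselect (k%:R / n.+1%:R < u :> R); last first.
  rewrite [X in smallest _ _ X](_ : _ = set0); first exact: sigma_algebra0.
  by apply/seteqP; split=> // w [].
apply: sub_sigma_algebra; exists (k%:R / n.+1%:R), [set z | h z < b].
split; [by rewrite divr_ge0|exact: ltW| |].
  apply: open_borel; rewrite -[X in open X]/(h @^-1` [set r | r < b]).
  by move/continuousP : ch; apply; exact: open_lt.
by apply/seteqP; split=> w //= [].
Qed.

Lemma measurable_dips_below : measurable hit.
Proof.
rewrite (_ : hit = \bigcup_(n : nat) (hit `&` [set w | tau w < n.+1%:R])).
  apply: bigcupT_measurable => n; apply: (natural_filtration_measurable hL).
  exact: adapted.
apply/seteqP; split=> w; last by move=> [n _ []].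
by move=> Aw; exists (Num.truncn (tau w)) => //; split=> //=; exact: truncnS_gt.
Qed.

Let mtau : measurable_fun setT tau.
Proof.
apply: measurable_lt_real => x; have [x0|x0] := leP x 0.
  rewrite (_ : [set _ | _] = set0)//; apply/seteqP; split=> // w /=.
  by rewrite ltNge (le_trans x0).
rewrite (_ : [set _ | _] = (hit `&` [set w | tau w < x]) `|` ~` hit).
  apply: measurableU; last by apply: measurableC; exact: measurable_dips_below.
  by apply: (natural_filtration_measurable hL); exact: adapted.
apply/seteqP; split=> w /=.
  by move=> wx; have [hw|hw] := pselect (hit w); [left|right].
by move=> [[]//|hw]; rewrite /tau asboolF.
Qed.

(** The infimum need not be attained, so right continuity gives a weak inequality only; the bound on
    the clock asks for no more. *)
Let h_tau w : hit w -> h (L (tau w) w) <= b.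
Proof.
move=> hw; rewrite leNgt; apply/negP => bh.
have : \forall r \near (tau w)^'+, b < h (L r w).
  have : h (L r w) @[r --> (tau w)^'+] --> h (L (tau w) w).
    by apply: (cvg_comp _ _ (cL w (tau0 w)).1); exact: ch.
  by move=> c; exact: (c _ (lt_nbhsr bh)).
rewrite /at_right near_withinE => /nbhs_ballP[e /= e0' eb].
have : tau w < tau w + e by rewrite ltrDl.
move=> /(tau_lt _ hw)[k [n [Nk ke hk]]].
have tk : tau w <= k%:R / n.+1%:R.
  rewrite {1}/tau asboolT//.
  by apply: ge_inf; [have [] := has_inf_times hw|].
move: tk; rewrite le_eqVlt => /predU1P[tk|tk].
  by move: hk; rewrite -tk ltNge (ltW bh).
have : b < h (L (k%:R / n.+1%:R) w).
  apply: eb => //; by rewrite /ball/= ltr0_norm ?subr_lt0// opprB ltrBlDl.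
by rewrite ltNge (ltW hk).
Qed.

(* If h o L falls below b after time N, the remaining integral is at least 1/b
   times an independent copy of the whole integral. *)
Lemma hit_tail_le (eps : R) : 0 < b -> 0 <= eps ->
  (P (hit `&` [set w | clock (fun s => rate h (L ^~ w) (N%:R + s)) +oo <= eps%:E]%E)
   <= P [set w | total w <= (b * eps)%:E]%E)%E.
Proof.
move=> b0 eps0.
pose D := cadlag_path R e0.
(* The event is measurable on cadlag paths; a path event [C] with the same trace is what the strong
   Markov property accepts. *)
pose S : set D := [set x : D | (clock (rate h x) +oo <= (b * eps)%:E)%E].
have mS : measurable S.
  have mcl := @measurable_clock R E h h0 ch _ D (fun s (x : D) => x s)
    (@borel_fun_coordinate R E e0) (fun x => @path_cadlag _ _ _ x) +oo%E.
  by rewrite -[X in measurable X]setTI; exact: emeasurable_fun_infty_c.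
have [C mC SC] := measurable_path_trace mS.
have SCP (x : R -> E) (cx : cadlag x) :
    C x <-> (clock (rate h x) +oo <= (b * eps)%:E)%E.
  have : S (CadlagPath e0 x cx) <-> C x by rewrite SC.
  by move=> <-.
have CE : [set w | total w <= (b * eps)%:E]%E = [set w | C (L ^~ w)].
  by apply/seteqP; split=> w; rewrite /total/=; apply SCP.
rewrite CE.
pose Q := hit `&` [set w | C (fun s => post mul inv L tau s w)].
have PQ : P Q = (P hit * law P L C)%E.
  exact: (levy_strong_markov hE sepE hL tau0 mtau adapted mC).
have mQ : measurable Q.
  apply: measurableI; first exact: measurable_dips_below.
  apply: path_measurable_preimage mC => s s0.
  exact: (borel_fun_post hE sepE hL tau0 mtau s0).
have PQle : (P Q <= P [set w | C (L ^~ w)])%E.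
  rewrite PQ /law -[leRHS]mul1e; apply: lee_wpmul2r; first exact: measure_ge0.
  by apply: probability_le1; exact: measurable_dips_below.
apply: le_trans PQle; apply: le_measure; rewrite ?inE//.
  apply: measurableI; first exact: measurable_dips_below.
  have mV s : 0 <= s -> borel_fun (fun w => L (N%:R + s) w).
    by move=> s0; apply: mL; rewrite addr_ge0.
  have cV w : cadlag (fun s => L (N%:R + s) w) by exact: (@cadlag_shift _ _ (L ^~ w)).
  have := measurable_clock h0 ch mV cV +oo%E.
  by move=> mc; rewrite -[X in measurable X]setTI; exact: emeasurable_fun_infty_c.
move=> w [hw /= tail]; split=> //=.
have cp := cadlag_post hE hL (tau0 w).
apply/(SCP _ cp).
set T := tau w.
have NT : 0 <= T - N%:R by rewrite subr_ge0; exact: tau_ge.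
have rgN : clock_rate (fun s => rate h (L ^~ w) (N%:R + s)).
  exact: (clock_rate_shift _ (rg (cL w))).
have rgT := clock_rate_shift NT rgN.
have /(clock_shift rgN) : 0 <= T - N%:R by [].
move=> /(_ +oo%E (leey _)); rewrite addey// => tailE.
have {tailE}tail' : (clock (fun s => rate h (L ^~ w) (N%:R + (T - N%:R + s))) +oo
    <= eps%:E)%E.
  apply: le_trans tail; rewrite tailE; apply: leeDr.
  exact: (clock_ge0 rgN).
(* Since [h] is multiplicative, the clock of the increments after [T] is the remaining clock times
   [h (L T w)], which is at most [b]. *)
have -> : clock (rate h (fun s => post mul inv L tau s w)) +oo%E =
    clock (fun s => h (L T w) * rate h (L ^~ w) (N%:R + (T - N%:R + s))) +oo%E.
  apply: eq_clock => s s0 _; rewrite /rate /post /increment hM hV invfM invrK.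
  by congr (_ * (h (L _ w))^-1); rewrite /T; lra.
rewrite clock_scale//; last exact: ltW.
rewrite EFinM; apply: lee_pmul => //; rewrite ?lee_fin ?(ltW (h0 _))//.
  exact: (clock_ge0 rgT).
exact: h_tau.
Qed.

End hitting.

Let tail N w := clock (fun s => rate h (L ^~ w) (N%:R + s)) +oo%E.

Let tailE N N' w : (N <= N')%N ->
  tail N w = (clock (fun s => rate h (L ^~ w) (N%:R + s)) (N'%:R - N%:R)%:E + tail N' w)%E.
Proof.
move=> NN'; have NN0 : 0 <= N'%:R - N%:R :> R by rewrite subr_ge0 ler_nat.
have rgN := clock_rate_shift (ler0n R N) (rg (cL w)).
rewrite /tail -[in LHS](@addey _ (N'%:R - N%:R)%:E)//.
rewrite clock_shift ?leey//; congr (_ + clock _ _)%E.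
by apply/funext => s; congr (rate _ _ _); lra.
Qed.

Let tail_ge0 N w : (0 <= tail N w)%E.
Proof. exact: (clock_ge0 (clock_rate_shift (ler0n R N) (rg (cL w)))). Qed.

Let tail0 w : tail 0 w = total w.
Proof. by apply: eq_clock => s _ _; rewrite add0r. Qed.

Let tail_le N N' w : (N <= N')%N -> (tail N' w <= tail N w)%E.
Proof.
move=> NN'; rewrite (tailE w NN'); apply: leeDr.
exact: (clock_ge0 (clock_rate_shift (ler0n R N) (rg (cL w)))).
Qed.

Let tail_small w eps : (total w < +oo)%E -> 0 < eps ->
  exists N, (tail N w <= eps%:E)%E.
Proof.
move=> ty eps0; have tfin : total w \is a fin_num.
  by rewrite ge0_fin_numE// -tail0.
(* A time at which all but [eps] of the finite total has elapsed leaves a tail below [eps]. *)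
have tlt : ((fine (total w) - eps)%:E < total w)%E.
  by rewrite -[ltRHS](fineK tfin) lte_fin ltrBlDr ltrDl.
have [u u0 tu] := clock_exceeds (rg (cL w)) tlt.
pose N := (Num.truncn u).+1; exists N.
have uN : (u%:E <= N%:R%:E)%E by rewrite lee_fin ltW// truncnS_gt.
have {}tu := lt_le_trans tu (clock_le (rg (cL w)) u0 uN).
have tN : (tail N w <= total w)%E by rewrite -tail0; exact: tail_le.
have tNfin : tail N w \is a fin_num.
  by rewrite ge0_fin_numE// (le_lt_trans tN).
have := tailE w (leq0n N); rewrite tail0 subr0.
rewrite (_ : (fun s => _) = rate h (L ^~ w)); last first.
  by apply/funext => s; rewrite add0r.
move: tu; rewrite -(fineK (clock_fin (rg (cL w)) _)) -(fineK tNfin) -{2}(fineK tfin).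
rewrite lte_fin -EFinD lee_fin => tu [tE].
lra.
Qed.

Let mtotal : measurable_fun setT total.
Proof. exact: (measurable_clock h0 ch mL cL). Qed.

Let mtail N : measurable_fun setT (tail N).
Proof.
apply: (measurable_clock h0 ch (V := fun s w => L (N%:R + s) w)).
  by move=> s s0; apply: mL; rewrite addr_ge0.
by move=> w; exact: (@cadlag_shift _ _ (L ^~ w)).
Qed.

Let null b : 0 < b ->
  P ([set w | total w < +oo]%E `&` \bigcap_(N : nat) dips_below N b) = 0%E.
Proof.
move=> b0; set bad := _ `&` _.
have mbad : measurable bad.
  apply: measurableI; last by apply: bigcapT_measurable => N; exact: measurable_dips_below.
  by rewrite -[X in measurable X]setTI; exact: emeasurable_fun_infty_o.
pose small m := [set w | (total w <= (b * m.+1%:R^-1)%:E)%E].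
have msmall m : measurable (small m).
  by rewrite -[X in measurable X]setTI; exact: emeasurable_fun_infty_c.
have bad_small m : (P bad <= P (small m))%E.
  (* On [bad] the tails tend to 0, so [bad] is the increasing union of the [F N], each bounded by
     [hit_tail_le] uniformly in [N]. *)
  pose F N := bad `&` [set w | (tail N w <= m.+1%:R^-1%:E)%E].
  have mtN N : measurable [set w | (tail N w <= m.+1%:R^-1%:E)%E].
    by rewrite -[X in measurable X]setTI; apply: emeasurable_fun_infty_c => //; exact: mtail.
  have mF N : measurable (F N) by exact: measurableI.
  have ndF : {homo F : N N' / (N <= N')%N >-> (N <= N')%O}.
    move=> N N' NN'; apply/subsetPset => w [bw tw]; split=> //.
    by apply: le_trans tw; exact: tail_le.
  have UF : \bigcup_N F N = bad.
    apply/seteqP; split=> w; first by move=> [N _ []].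
    move=> bw; have m0 : 0 < m.+1%:R^-1 :> R by rewrite invr_gt0.
    have [N tN] := tail_small bw.1 m0.
    by exists N.
  have mU : measurable (\bigcup_N F N) by rewrite UF.
  have := nondecreasing_cvg_mu (mu := P) mF mU ndF; rewrite UF => cF.
  apply: (cvge_le _ cF); apply: nearW => N /=.
  have m0 : 0 <= m.+1%:R^-1 :> R by rewrite invr_ge0.
  apply: le_trans (hit_tail_le N b0 m0); apply: le_measure; rewrite ?inE//.
    by apply: measurableI; [exact: measurable_dips_below|exact: mtN].
  by move=> w [[_ bw] tw]; split=> //; exact: bw.
have ni : {homo small : m n / (m <= n)%N >-> (n <= m)%O}.
  move=> m n mn; apply/subsetPset => w /le_trans; apply.
  by rewrite lee_fin ler_pM2l// lef_pV2 ?posrE// ler_nat ltnS.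
(* The total clock is positive, so it cannot lie below [b / (m + 1)] for every [m]. *)
have cap0 : \bigcap_m small m = set0.
  apply/seteqP; split=> // w sw.
  have t0 : (0 < total w)%E by apply: (clock_gt0 (rg (cL w))); exact: ltry.
  have tfin : total w \is a fin_num.
    by rewrite ge0_fin_numE ?ltW// (le_lt_trans (sw 0%N I))// ltry.
  have r0 : 0 < fine (total w) / b by rewrite divr_gt0// -lte_fin fineK.
  have [m _ /(_ m (leqnn _)) /= rm] := near_infty_natSinv_lt (PosNum r0).
  have := sw m I; rewrite /small/= -(fineK tfin) lee_fin leNgt => /negP; apply.
  by rewrite mulrC -ltr_pdivlMr.
have Pfin : (P (small 0%N) < +oo)%E.
  by rewrite (le_lt_trans (probability_le1 _ _)) ?ltry.
have mcap : measurable (\bigcap_m small m) by rewrite cap0.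
have := nonincreasing_cvg_mu Pfin msmall mcap ni; rewrite cap0 measure0 => c0.
apply/eqP; rewrite eq_le measure_ge0 andbT.
by apply: (cvge_ge _ c0); apply: nearW => m; exact: bad_small.
Qed.

Lemma levy_escape : {ae P, forall w, (clock (rate h (L ^~ w)) +oo < +oo)%E ->
  forall b, \forall s \near +oo, b <= h (L s w)}.
Proof.
pose bad (n : nat) := [set w | total w < +oo]%E `&` \bigcap_(N : nat) dips_below N n.+1%:R.
apply: (@negligibleS _ _ _ P (\bigcup_n bad n)); last first.
  apply: negligible_bigcup => n; apply/negligibleP; last exact: null.
  apply: measurableI; last by apply: bigcapT_measurable => N; exact: measurable_dips_below.
  by rewrite -[X in measurable X]setTI; exact: emeasurable_fun_infty_o.
move=> w /=; apply: contra_notP => nbad ty b.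
(* Integer levels keep the exceptional set a countable union, and [n.+1] exceeds [b]. *)
pose n := Num.truncn b.
have [N Nb] : exists N, ~ dips_below N n.+1%:R w.
  apply: contrapT => nex; apply: nbad; exists n => //; split=> // N _.
  by apply: contrapT => nd; apply: nex; exists N.
near=> s; rewrite leNgt; apply/negP => hb; apply: Nb; exists s.
  by near: s; exact: nbhs_pinfty_ge.
by apply: (lt_trans hb); exact: truncnS_gt.
Unshelve. all: by end_near. Qed.

End escape.

(** * The time-changed process *)

(** An open set of extended reals is an open set of reals with some of the two infinite points
    added. *)
Lemma borel_emeasurable {R : realType} (B : set (\bar R)) : borel B -> measurable B.
Proof.
apply: smallest_sub; first exact: sigma_algebra_measurable.
move=> U oU; rewrite (_ : U = [set x%:E | x in EFin @^-1` U] `|`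
    ((U `&` [set -oo%E]) `|` (U `&` [set +oo%E]))).
  have mpt (a : \bar R) : measurable (U `&` [set a]).
    have [Ua|Ua] := pselect (U a).
      rewrite (_ : _ `&` _ = [set a]); first exact: emeasurable_set1.
      by apply/seteqP; split=> [x []//|x /= ->].
    rewrite (_ : _ `&` _ = set0); first exact: measurable0.
    by apply/seteqP; split=> // x [Ux /= xa]; apply: Ua; rewrite -xa.
  apply: measurableU; last by apply: measurableU; exact: mpt.
  apply: measurable_image_EFin; apply: open_measurable.
  by apply: open_comp oU => x _ A ?; exact/nbhs_EFin.
apply/seteqP; split=> [[x||] Ux|x].
- by left; exists x.
- by right; right.
- by right; left.
- by move=> [[r Ur <-]//|[[]//|[]//]].
Qed.

(** On [tau < u] the value [L (tau w) w] is read off the path stopped at [u], sampled at a time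
    measurable for the past up to [u]. *)
Lemma natural_filtration_random_time {R : realType} {E : metricType R} {d}
    {Omega : measurableType d} (L : R -> Omega -> E) (tau : Omega -> R) A B u :
  (forall w, cadlag (L ^~ w)) -> (forall w, 0 <= tau w) ->
  (forall v, 0 < v -> natural_filtration L v (A `&` [set w | tau w < v])) ->
  0 < u -> borel B ->
  natural_filtration L u (A `&` [set w | tau w < u] `&` [set w | B (L (tau w) w)]).
Proof.
move=> cL tau0 adapted u0 mB.
pose W : measurableType _ := g_sigma_algebraType
  [set A | exists s B, [/\ 0 <= s, s <= u, borel B & A = L s @^-1` B]].
pose L' s (w : W) := L (Num.min s u) w.
have mL' s : 0 <= s -> borel_fun (L' s).
  move=> s0 F mF; apply: sub_sigma_algebra.
  exists (Num.min s u), F; split=> //; first by rewrite le_min s0 ltW.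
  by rewrite ge_min lexx orbT.
have cL' w : cadlag (L' ^~ w) by exact: (cadlag_stop (ltW u0) (cL w)).
set S := A `&` _.
have mS : @measurable _ W S by exact: adapted.
(* Off [S] the past up to [u] need not determine [tau]; the default 0 makes [T] measurable for
   it. *)
pose T (w : W) : R := if w \in S then tau w else 0.
have T0 w : 0 <= T w by rewrite /T; case: ifP.
have mT : measurable_fun setT T.
  apply: measurable_lt_real => x; have [x0|x0] := leP x 0.
    rewrite (_ : [set w | T w < x] = set0)//; apply/seteqP; split=> // w /=.
    by rewrite ltNge (le_trans x0).
  rewrite (_ : [set w | T w < x] = (A `&` [set w | tau w < Num.min x u]) `|` ~` S).
    apply: measurableU; last exact: measurableC.
    apply: (@natural_filtration_le _ _ _ _ _ (Num.min x u)).
      by rewrite ge_min lexx orbT.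
    by apply: adapted; rewrite lt_min x0.
  apply/seteqP; split=> w; rewrite /T/=.
    case: ifPn => [/set_mem[Aw tu] tx|/negP nS _]; last by right => Sw; apply: nS; rewrite inE.
    by left; split=> //=; rewrite lt_min tx.
  move=> [[Aw]|nS]; last by rewrite ifN//; apply/negP => /set_mem.
  by rewrite /= lt_min => /andP[tx tu]; rewrite ifT// inE.
rewrite (_ : _ `&` _ = S `&` (fun w => L' (T w) w) @^-1` B).
  apply: (@measurableI _ W) => //.
  have : borel_fun (fun w => L' (T w) w).
    by apply: borel_fun_random_time => // w s s0; exact: (cL' w s s0).1.
  exact.
have LT w : S w -> L' (T w) w = L (tau w) w.
  by move=> Sw; rewrite /T ifT ?inE// /L' min_l// ltW//; case: Sw.
by apply/seteqP; split=> w [Sw /= Bw]; split=> //=; rewrite ?LT// -LT.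
Qed.

Section time_changed_levy.
Context {R : realType} {E : metricType R}.
Variables (mul : E -> E -> E) (inv : E -> E) (e0 : E) (h : E -> R).
Context {d : measure_display} {Omega : measurableType d}.
Variables (P : probability Omega R) (L : R -> Omega -> E).
Hypothesis hE : topological_group mul inv e0.
Hypothesis lcE : locally_compact [set: E].
Hypothesis sepE : Defs.separable E.
Hypothesis hh : positive_character mul h.
Hypothesis hL : levy_process P mul inv e0 L.

Let h0 z : 0 < h z. Proof. by case: hh. Qed.
Let hM x y : h (mul x y) = h x * h y. Proof. by case: hh. Qed.
Let ch : continuous h. Proof. by case: hh. Qed.
Let cmul : continuous (fun p : E * E => mul p.1 p.2). Proof. by case: hE => _ []. Qed.
Let cinv : continuous inv. Proof. by case: hE => _ []. Qed.
Let mulA : associative mul. Proof. by case: hE => -[]. Qed.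
Let mul1 : left_id e0 mul. Proof. by case: hE => -[]. Qed.
Let mulr1 : right_id e0 mul. Proof. by case: hE => -[]. Qed.
Let mulV : left_inverse e0 inv mul. Proof. by case: hE => -[]. Qed.
Let mulrV : right_inverse e0 inv mul. Proof. by case: hE => -[]. Qed.
Let mL s : 0 <= s -> borel_fun (L s).
Proof. by move=> s0 B mB; exact: (levy_measurable hL). Qed.
Let cL w : cadlag (L ^~ w) := levy_cadlag hL w.
Let rg (x : R -> E) (cx : cadlag x) := cadlag_clock_rate lcE h0 ch cx.

Local Notation X := (time_changed mul h L).
Let V y s w := mul y (L s w).

Let cmull y : continuous (mul y).
Proof.
move=> z; apply: (@continuous_comp _ _ _ (fun z => (y, z))
  (fun p : E * E => mul p.1 p.2)); last exact: cmul.
by apply: cvg_pair => //=; exact: cvg_cst.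
Qed.

Let mV y s : 0 <= s -> borel_fun (V y s).
Proof. by move=> s0; exact: (continuous_borel_fun (@cmull y) (mL s0)). Qed.

Let cV y w : cadlag (V y ^~ w).
Proof. exact: (cadlag_continuous (@cmull y) (cL w)). Qed.

Let phiE y w t : phi h L y w t = clock (rate h (V y ^~ w)) t.
Proof.
have c0 : 0 <= (h y)^-1 by rewrite invr_ge0 ltW.
transitivity ((h y)^-1%:E * clock (rate h (L ^~ w)) t)%E; first by [].
rewrite -(clock_scale _ (rg (cL w)) c0); apply: eq_clock => s s0 _.
by rewrite /rate hM invfM.
Qed.

Let XE y : X y = fun t w => lamperti h (V y ^~ w) t.
Proof.
apply/funext => t; apply/funext => w; rewrite /time_changed /lamperti phiE.
case: ifP => // _; rewrite /phi_inv /clock_inv.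
by congr (Some (mul y (L ('pinv_ _ _ _ _) w))); apply/funext => s; rewrite phiE.
Qed.

Let V0 y : {ae P, forall w, V y 0 w = y}.
Proof.
by apply: filterS (levy_start hL) => w; rewrite /V => ->; rewrite mulr1.
Qed.

(** The statement is almost sure because the path really starts at [mul y (L 0 w)], which equals [y]
    only up to a null set. *)
Lemma time_changed_lifetime y :
  {ae P, forall w, lifetime y (fun t => X y t w) = phi h L y w +oo%E}.
Proof.
apply: filterS (V0 y) => w Vy.
by rewrite phiE XE -{1}Vy; exact: (lamperti_lifetime lcE h0 ch (cV y w)).
Qed.

Let phi_total y w : phi h L y w +oo%E = ((h y)^-1%:E *
  \int[lebesgue_measure]_(s in [set s : R | (0 <= s)%R])
    (expR (ln (h (L s w))^-1))%:E)%E.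
Proof.
rewrite /phi; congr (_ * _)%E.
rewrite (_ : [set s : R | _ /\ _] = [set s : R | 0 <= s]); last first.
  by apply/seteqP; split=> s /=; rewrite leey// => -[].
by apply: eq_integral => s _; rewrite lnK// posrE invr_gt0.
Qed.

Lemma time_changed_lifetime_exp y : {ae P, forall w,
  lifetime y (fun t => X y t w) = ((h y)^-1%:E *
    \int[lebesgue_measure]_(s in [set s : R | (0 <= s)%R])
      (expR (ln (h (L s w))^-1))%:E)%E}.
Proof.
by apply: filterS (time_changed_lifetime y) => w ->; exact: phi_total.
Qed.

Let mX y t : 0 <= t -> borel_fun (X y t).
Proof.
move=> t0; rewrite XE.
exact: (lamperti_borel_fun lcE h0 ch (@mV y) (cV y) t0).
Qed.

Lemma time_changed_cadlag : cadlag_family P X.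
Proof.
move=> y; split; first by move=> t B t0 mB; exact: mX.
have esc := levy_escape hE lcE sepE hh hL.
apply: filterS2 (V0 y) esc => w Vy esc.
rewrite XE -{1}Vy; apply: (lamperti_lifetime_path lcE h0 ch (cV y w)).
rewrite -phiE => py K cK.
have {}py : (clock (rate h (L ^~ w)) +oo < +oo)%E.
  rewrite ltey; apply/negP => /eqP ty; move: py.
  rewrite (_ : phi _ _ _ _ _ = ((h y)^-1%:E * clock (rate h (L ^~ w)) +oo)%E)//.
  by rewrite ty gt0_muley ?ltxx// lte_fin invr_gt0.
have /compact_bounded[M [_ MK]] : compact (h @` K).
  by apply: continuous_compact => //; exact: continuous_subspaceT.
have hK z : K z -> h z <= M + 1.
  move=> Kz; apply: le_trans (ler_norm _) _.
  by apply: (MK (M + 1)); [rewrite ltrDl|exists z].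
(* On [K] the function [h] is at most [M + 1]; the level is divided by [h y] because the path in
   question is [mul y (L s w)]. *)
have := esc py ((M + 2) / h y); apply: filterS => s hs Ks.
have := hK _ Ks; rewrite hM; move: hs; rewrite ler_pdivrMr// mulrC.
lra.
Qed.

(** The two processes agree path by path at nonnegative times, which is stronger than equality in
    law. *)
Lemma time_changed_invariance :
  invariance_components P X e0 (fun y x => mul y x) h.
Proof.
split=> //; first exists (fun y x => mul (inv y) x).
  split=> //.
  - by move=> y x; rewrite mulA mulV mul1.
  - by move=> y x; rewrite mulA mulrV mul1.
  - move=> p; apply: (@continuous_comp _ _ _ (fun p : E * E => (inv p.1, p.2))
      (fun p : E * E => mul p.1 p.2)); last exact: cmul.
    apply: cvg_pair => /=; last exact: cvg_snd.
    by apply: continuous_comp; [exact: cvg_fst|exact: cinv].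
move=> y C mC; congr (P _).
have XX w t : 0 <= t -> X y t w = omap (mul y) (X e0 (h y * t) w).
  move=> t0; rewrite !XE.
  have V1 : V e0 ^~ w = L ^~ w by apply/funext => s; rewrite /V mul1.
  rewrite V1.
  have rgL := rg (cL w).
  have hy0 : 0 <= (h y)^-1 by rewrite invr_ge0 ltW.
  have rE (u : \bar R) : clock (rate h (V y ^~ w)) u =
      ((h y)^-1%:E * clock (rate h (L ^~ w)) u)%E.
    rewrite -(clock_scale _ rgL hy0); apply: eq_clock => s s0 _.
    by rewrite /rate hM invfM.
  have hyt0 : 0 <= h y * t by rewrite mulr_ge0// ltW.
  rewrite /lamperti rE.
  rewrite lte_pdivlMl//; case: ifPn => // ty /=; congr (Some (mul y (L _ w))).
  apply: (clock_invE (rg (cV y w))); first exact: (clock_inv_ge0 rgL).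
  by rewrite rE (clock_invK rgL)// -EFinM mulKf// gt_eqF.
apply/seteqP; split=> w /=; apply: (path_measurable_ext mC) => s s0.
  exact: XX.
by rewrite -XX.
Qed.

(** The functional to be frozen: the process started from [z] is in [C] exactly when the pair of [z]
    and the path of [L] is in this set. *)
Let event (C : set (R -> one_point_compactification E)) :
    set (borel_space e0 * cadlag_path R e0) :=
  [set p : borel_space e0 * cadlag_path R e0 |
    C (lamperti h (fun s : R => mul p.1 (p.2 s)))].

Let measurable_event C : path_measurable C -> measurable (event C).
Proof.
move=> mC.
apply: (path_measurable_preimage
  (Y := fun t (p : borel_space e0 * cadlag_path R e0) =>
    lamperti h (fun s => mul p.1 (p.2 s)) t) _ mC) => t t0.
apply: (lamperti_borel_fun lcE h0 ch
  (V := fun s (p : borel_space e0 * cadlag_path R e0) => mul p.1 (p.2 s))) => //.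
  move=> s s0.
  apply: (continuous_borel_fun cmul
    (f := fun p : borel_space e0 * cadlag_path R e0 => (p.1 : E, p.2 s))).
  apply: borel_fun_pair => //.
    by apply: (@measurable_fun_borel_fun _ e0); exact: measurable_fst.
  move=> B mB; rewrite -[X in measurable X]setTI.
  exact: (measurable_snd measurableT _ (borel_fun_coordinate s0 mB)).
by move=> p; exact: (cadlag_continuous (@cmull p.1) (path_cadlag p.2)).
Qed.

Let law_event y C :
  law P (X y) C = P [set w | event C (y, CadlagPath e0 (L ^~ w) (cL w))].
Proof. by rewrite /law /event XE. Qed.

Lemma measurable_time_changed_law C (B : set (\bar R)) : path_measurable C ->
  borel B -> borel [set y | B (law P (X y) C)].
Proof.
move=> mC /borel_emeasurable mB.
have := @measurable_frozen_law R E e0 _ _ P L mL cL _ (measurable_event mC).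
move=> /(_ measurableT _ mB); rewrite setTI.
by under eq_set do rewrite law_event.
Qed.

Let natural_filtration_mul y u A : natural_filtration (V y) u A ->
  natural_filtration L u A.
Proof.
apply: sub_sigma_algebra2 => _ [s [B [s0 su mB ->]]].
by exists s, (mul y @^-1` B); split=> //; exact: (continuous_borel (@cmull y)).
Qed.

(** * Strong Markov property of the time-changed process *)

Section stopping.
Variables (y : E) (tau : Omega -> \bar R).
Hypothesis stop : stopping_time (right_limits (natural_filtration (X y))) tau.

Let tau_ge0 w : (0 <= tau w)%E. Proof. by case: stop. Qed.

Let total w := clock (rate h (V y ^~ w)) +oo%E.
Let rgV w := rg (cV y w).

Let stopped A := stopped_sigma (right_limits (natural_filtration (X y))) tau A.

(** Strict inequality removes the right limit of the filtration: [tau <= q - 1 / (m + 1)] is known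
    at any later time, in particular at [q]. *)
Let stopped_lt A q : stopped A -> 0 <= q ->
  natural_filtration (X y) q (A `&` [set w | (tau w < q%:E)%E]).
Proof.
move=> sA q0.
rewrite (_ : _ `&` _ = \bigcup_m (A `&` [set w | (tau w <= (q - m.+1%:R^-1)%:E)%E])).
  apply: sigma_algebra_bigcup => m.
  have [qm|qm] := leP 0 (q - m.+1%:R^-1).
    by apply: (sA _ qm); rewrite /= ltrBlDr ltrDl.
  rewrite [X in smallest _ _ X](_ : _ = set0); first exact: sigma_algebra0.
  apply/seteqP; split=> // w [_ /=]; rewrite leNgt => /negP; apply.
  by apply: lt_le_trans (tau_ge0 w); rewrite lte_fin.
apply/seteqP; split=> w; last first.
  move=> [m _ [Aw /= tm]]; split=> //=.
  by apply: (le_lt_trans tm); rewrite lte_fin ltrBlDr ltrDl.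
move=> [Aw /= tq].
have tfin : tau w \is a fin_num by rewrite ge0_fin_numE// (lt_trans tq)// ltry.
have e0' : 0 < q - fine (tau w) by rewrite subr_gt0 -lte_fin fineK.
have [m _ /(_ m (leqnn _)) /= mq] := near_infty_natSinv_lt (PosNum e0').
exists m => //; split=> //=; rewrite -(fineK tfin) lee_fin.
by rewrite lerBrDl -lerBrDr ltW.
Qed.

(** A rational [q] inserted between [tau] and the clock at [u] decouples them: [tau < q] concerns
    [X] up to [q], and where [q] is below the clock at [u] that past is determined by [L] up to
    [u]. *)
Let stopped_clock A u : stopped A -> 0 <= u ->
  natural_filtration L u
    (A `&` [set w | (tau w < clock (rate h (V y ^~ w)) u%:E)%E]).
Proof.
move=> sA u0.
pose q k n : R := k%:R / n.+1%:R.
rewrite (_ : _ `&` _ = \bigcup_k \bigcup_n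
    ((A `&` [set w | (tau w < (q k n)%:E)%E]) `&`
    [set w | ((q k n)%:E < clock (rate h (V y ^~ w)) u%:E)%E])).
  apply: sigma_algebra_bigcup => k; apply: sigma_algebra_bigcup => n.
  have q0 : 0 <= q k n by rewrite divr_ge0.
  apply: (natural_filtration_mul (y := y)).
  apply: (natural_filtration_lamperti lcE h0 ch (cV y) q0 u0).
  by rewrite -XE; exact: stopped_lt.
apply/seteqP; split=> w; last first.
  by move=> [k _ [n _ [[Aw /= t1] /= t2]]]; split=> //=; exact: lt_trans t2.
move=> [Aw /= tu].
have cfin := clock_fin (rgV w) u.
have tfin : tau w \is a fin_num.
  by rewrite ge0_fin_numE// (lt_le_trans tu)// leey.
have : fine (tau w) < fine (clock (rate h (V y ^~ w)) u%:E).
  by rewrite -lte_fin !fineK.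
move=> tu'; have t0 : 0 <= fine (tau w) by rewrite fine_ge0.
have near_u : \forall r \near (fine (tau w))^'+,
    r < fine (clock (rate h (V y ^~ w)) u%:E) by exact: nbhs_right_lt.
have [n _ /(_ n (leqnn _)) /= ku] := grid_above_cvg t0 near_u.
exists (Num.truncn (n.+1%:R * fine (tau w))).+1 => //; exists n => //.
split; last by rewrite /= -(fineK cfin) lte_fin.
by split=> //=; rewrite -[tau w](fineK tfin) lte_fin; exact: grid_above_gt.
Qed.

Let T w : R := if (tau w < total w)%E
  then clock_inv (rate h (V y ^~ w)) (fine (tau w)) else 0.

Let tau_fin w : (tau w < total w)%E -> tau w \is a fin_num.
Proof. by move=> tt; rewrite ge0_fin_numE// (lt_le_trans tt)// leey. Qed.

Let T0 w : 0 <= T w.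
Proof.
rewrite /T; case: ifPn => // tt; apply: (clock_inv_ge0 (rgV w)).
  by rewrite fine_ge0.
by rewrite fineK// tau_fin.
Qed.

Let T_lt w u : (tau w < total w)%E -> 0 <= u ->
  (T w < u) = (tau w < clock (rate h (V y ^~ w)) u%:E)%E.
Proof.
move=> tt u0; rewrite /T tt (clock_inv_lt (rgV w)) ?fine_ge0//.
  by rewrite fineK// tau_fin.
by rewrite fineK// tau_fin.
Qed.

Let aliveE A u : 0 <= u ->
  A `&` [set w | (tau w < total w)%E] `&` [set w | T w < u] =
  A `&` [set w | (tau w < clock (rate h (V y ^~ w)) u%:E)%E].
Proof.
move=> u0; apply/seteqP; split=> w.
  by move=> [[Aw /= tt] /=]; rewrite T_lt.
move=> [Aw /= tu].
have tt : (tau w < total w)%E.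
  by apply: (lt_le_trans tu); apply: (clock_le (rgV w) u0); exact: leey.
by split; [split|rewrite /= T_lt].
Qed.

Let adapted A u : stopped A -> 0 <= u -> natural_filtration L u
  (A `&` [set w | (tau w < total w)%E] `&` [set w | T w < u]).
Proof. by move=> sA u0; rewrite aliveE//; exact: stopped_clock. Qed.

Let stoppedT : stopped setT.
Proof. by move=> t t0; rewrite setTI; case: stop => _; exact. Qed.

Let malive A : stopped A -> measurable (A `&` [set w | (tau w < total w)%E]).
Proof.
move=> sA; rewrite (_ : _ `&` _ = \bigcup_(n : nat)
    (A `&` [set w | (tau w < total w)%E] `&` [set w | T w < n.+1%:R])).
  apply: bigcupT_measurable => n; apply: (natural_filtration_measurable hL).
  exact: adapted.
apply/seteqP; split=> w; last by move=> [n _ []].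
by move=> Aw; exists (Num.truncn (T w)) => //; split=> //=; exact: truncnS_gt.
Qed.

Let mT : measurable_fun setT T.
Proof.
have ma := malive stoppedT; rewrite setTI in ma.
apply: measurable_lt_real => x; have [x0|x0] := leP x 0.
  rewrite (_ : [set _ | _] = set0)//; apply/seteqP; split=> // w /=.
  by rewrite ltNge (le_trans x0).
rewrite (_ : [set _ | _] =
    (setT `&` [set w | (tau w < total w)%E] `&` [set w | T w < x]) `|`
    ~` [set w | (tau w < total w)%E]).
  apply: measurableU; last exact: measurableC.
  by apply: (natural_filtration_measurable hL); apply: adapted => //; exact: ltW.
apply/seteqP; split=> w /=.
  by move=> wx; have [tt|/negP tt] := boolP (tau w < total w)%E; [left|right].
by move=> [[]//|/negP/negbTE tt]; rewrite /T tt.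
Qed.

Let Z w := mul y (L (T w) w).

Let mZ : borel_fun Z.
Proof.
apply: (continuous_borel_fun (@cmull y)).
by apply: borel_fun_random_time => // w s s0; exact: (cL w s0).1.
Qed.

Let Y := post mul inv L T.

Let mY s : 0 <= s -> borel_fun (Y s).
Proof. by move=> s0; exact: (borel_fun_post hE sepE hL). Qed.

Let cY w : cadlag (Y ^~ w).
Proof. exact: (cadlag_post hE hL). Qed.

(** The state [Z] belongs to the past of [T], so intersecting with a condition on [Z] preserves the
    adaptedness required by the strong Markov property of [L]. *)
Let alive_indep A F C : stopped A -> borel F -> path_measurable C ->
  P (A `&` [set w | (tau w < total w)%E] `&` Z @^-1` F `&` [set w | C (Y ^~ w)]) =
  (P (A `&` [set w | (tau w < total w)%E] `&` Z @^-1` F) * law P L C)%E.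
Proof.
move=> sA mF mC; apply: (levy_strong_markov hE sepE hL T0 mT) => // u u0.
rewrite setIAC.
apply: (natural_filtration_random_time (B := mul y @^-1` F)) => //.
  by move=> v v0; apply: adapted => //; exact: ltW.
exact: (continuous_borel (@cmull y)).
Qed.

Let alive_state w : (tau w < total w)%E -> X y (fine (tau w)) w = Some (Z w).
Proof.
by move=> tt; rewrite XE /lamperti fineK ?tau_fin// ifT// /Z /T tt.
Qed.

Let alive_path w t : (tau w < total w)%E -> 0 <= t ->
  X y (fine (tau w) + t) w = lamperti h (fun s => mul (Z w) (Y s w)) t.
Proof.
move=> tt t0; rewrite XE (lamperti_shift lcE h0 ch (cV y w))//; last 2 first.
- by rewrite fine_ge0.
- by rewrite fineK// tau_fin.
congr (lamperti h _ t); apply/funext => s.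
rewrite /Z /Y /post /increment -mulA [mul (L (T w) w) _]mulA mulrV mul1.
by rewrite /V /T tt.
Qed.

Let state_law C w := law P (from_state X (X y (fine (tau w)) w)) C.

Let alive_law C w : (tau w < total w)%E ->
  state_law C w = P [set w' | event C (Z w, CadlagPath e0 (L ^~ w') (cL w'))].
Proof. by move=> tt; rewrite /state_law alive_state// law_event. Qed.

Let alive_event A C : path_measurable C ->
  A `&` [set w | (tau w < total w)%E] `&`
    [set w | C (fun t => X y (fine (tau w) + t) w)] =
  A `&` [set w | (tau w < total w)%E] `&`
    [set w | event C (Z w, CadlagPath e0 (Y ^~ w) (cY w))].
Proof.
move=> mC; apply/seteqP; split=> w [[Aw tt] /= Cw]; split=> //=;
  apply: (path_measurable_ext mC _ Cw) => s s0; first exact: alive_path.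
by rewrite alive_path.
Qed.

Let alive_markov A C : stopped A -> path_measurable C ->
  let A1 := A `&` [set w | (tau w < total w)%E] in
  P (A1 `&` [set w | C (fun t => X y (fine (tau w) + t) w)]) =
  (\int[P]_(w in A1) state_law C w)%E.
Proof.
move=> sA mC A1.
have := freezing (malive sA) mZ mL mY cL cY
  (fun F C => @alive_indep A F C sA) (measurable_event mC).
rewrite -/A1 => fr.
rewrite /A1 alive_event//; rewrite -/A1.
rewrite fr; apply: eq_integral => w /set_mem[_ tt].
by rewrite alive_law.
Qed.

Let malive_law A C : stopped A -> path_measurable C ->
  measurable_fun (A `&` [set w | (tau w < total w)%E]) (state_law C).
Proof.
move=> sA mC.
apply: (eq_measurable_fun
  (fun w => P [set w' | event C (Z w, CadlagPath e0 (L ^~ w') (cL w'))])).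
  by move=> w /set_mem[_ tt]; rewrite alive_law.
apply: measurable_funTS.
apply: (measurableT_comp (measurable_frozen_law P mL cL (measurable_event mC))).
exact: borel_fun_measurable_fun.
Qed.

Let dead w : Prop := (total w <= tau w)%E /\ (tau w < +oo)%E.

Let dead_path w t : dead w -> 0 <= t -> X y (fine (tau w) + t) w = None.
Proof.
move=> [tt ty] t0; rewrite XE /lamperti ifN// -leNgt.
have tfin : tau w \is a fin_num by rewrite ge0_fin_numE.
by apply: (le_trans tt); rewrite EFinD fineK// leeDl// lee_fin.
Qed.

Let dead_law C w : dead w ->
  state_law C w = law P (fun _ _ => None : one_point_compactification E) C.
Proof.
by move=> dw; rewrite /state_law -[fine _]addr0 dead_path.
Qed.

Let dead_event A C : path_measurable C ->
  A `&` dead `&` [set w | C (fun t => X y (fine (tau w) + t) w)] =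
  A `&` dead `&` [set w | C (fun _ => None)].
Proof.
move=> mC; apply/seteqP; split=> w [[Aw dw] /= Cw]; split=> //=;
  apply: (path_measurable_ext mC _ Cw) => s s0; first exact: dead_path.
by rewrite dead_path.
Qed.

(** From the cemetery the future is deterministic: depending on whether the constant path [None] is
    in [C], both sides are the probability of [A] intersected with [dead], or 0. *)
Let dead_markov A C : measurable (A `&` dead) -> path_measurable C ->
  P (A `&` dead `&` [set w | C (fun t => X y (fine (tau w) + t) w)]) =
  (\int[P]_(w in A `&` dead) state_law C w)%E.
Proof.
move=> mA mC.
have -> : (\int[P]_(w in A `&` dead) state_law C w =
    \int[P]_(w in A `&` dead)
      law P (fun _ _ => None : one_point_compactification E) C)%E.
  by apply: eq_integral => w /set_mem[_ dw]; exact: dead_law.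
rewrite integral_cst// /law dead_event//.
have [CN|CN] := pselect (C (fun _ => None)).
  rewrite (_ : [set w | C (fun _ => None)] = setT); last by apply/seteqP; split.
  by rewrite probability_setT mul1e setIT.
rewrite (_ : [set w | C (fun _ => None)] = set0); last by apply/seteqP; split.
by rewrite setI0 !measure0 mul0e.
Qed.

Let mfinite A : stopped A -> measurable (A `&` [set w | (tau w < +oo)%E]).
Proof.
move=> sA; rewrite (_ : _ `&` _ = \bigcup_(n : nat)
    (A `&` [set w | (tau w < n.+1%:R%:E)%E])).
  apply: bigcupT_measurable => n.
  have : natural_filtration (X y) n.+1%:R (A `&` [set w | (tau w < n.+1%:R%:E)%E]).
    exact: stopped_lt.
  apply: smallest_sub; first exact: sigma_algebra_measurable.
  by move=> _ [s [B [s0 _ mB ->]]]; exact: mX.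
apply/seteqP; split=> w; last first.
  by move=> [n _ [Aw /= tn]]; split=> //=; exact: (lt_trans tn (ltry _)).
move=> [Aw /= ty]; exists (Num.truncn (fine (tau w))) => //; split=> //=.
have tfin : tau w \is a fin_num by rewrite ge0_fin_numE.
by rewrite -(fineK tfin) lte_fin; exact: truncnS_gt.
Qed.

Lemma time_changed_strong_markov A C : stopped A -> path_measurable C ->
  let A' := A `&` [set w | (tau w < +oo)%E] in
  P (A' `&` [set w | C (fun t => X y (fine (tau w) + t) w)]) =
  (\int[P]_(w in A') law P (from_state X (X y (fine (tau w)) w)) C)%E.
Proof.
move=> sA mC A'.
pose A1 := A `&` [set w | (tau w < total w)%E].
have mA' : measurable A' := mfinite sA.
have mA1 : measurable A1 := malive sA.
have AE : A' = A1 `|` (A `&` dead).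
  apply/seteqP; split=> w.
    move=> [Aw ty]; have [tt|tt] := ltP (tau w) (total w); first by left.
    by right.
  move=> [[Aw /= tt]|[Aw [_ ty]]]; split=> //=.
  by apply: (lt_le_trans tt); exact: leey.
have mA2 : measurable (A `&` dead).
  rewrite (_ : A `&` dead = A' `\` A1); first exact: measurableD.
  apply/seteqP; split=> w.
    move=> [Aw [tt ty]]; split=> // -[_ /=]; rewrite ltNge; exact/negP/negPn.
  move=> [[Aw ty] nA1]; split=> //; split=> //; rewrite leNgt; apply/negP => tt.
  by apply: nA1.
have dis : [disjoint A1 & A `&` dead].
  apply/disj_setPS => w [[_ /= tt] [_ [tt' _]]].
  by move: tt; rewrite ltNge tt'.
rewrite AE ge0_integral_setU//; last first.
  apply/measurable_funU => //; split; first exact: malive_law.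
  apply: (eq_measurable_fun
    (fun w => law P (fun _ _ => None : one_point_compactification E) C)).
    by move=> w /set_mem[_ dw]; exact/esym/dead_law.
  exact: measurable_cst.
rewrite -[X in (X + _)%E]alive_markov// -[X in (_ + X)%E]dead_markov// setIUl.
apply: measureU.
- rewrite /A1 alive_event//; apply: measurableI => //.
  rewrite -[X in measurable X]setTI.
  have mp : measurable_fun setT (fun w => (Z w, CadlagPath e0 (Y ^~ w) (cY w))
      : borel_space e0 * cadlag_path R e0).
    apply: measurable_fun_pair; first exact: borel_fun_measurable_fun.
    exact: measurable_cadlag_path.
  exact: (mp measurableT _ (measurable_event mC)).
- rewrite dead_event//; apply: measurableI => //.
  have [CN|CN] := pselect (C (fun _ => None)).
    by rewrite (_ : [set _ | _] = setT)//; apply/seteqP; split.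
  by rewrite (_ : [set _ | _] = set0)//; apply/seteqP; split.
- move: dis => /disj_setPS dis; apply/seteqP; split=> // w [[A1w _] [A2w _]].
  exact: (dis w).
Qed.

End stopping.

Lemma time_changed_general_self_similarity : general_self_similarity P X.
Proof.
split; first exact: time_changed_cadlag.
  split=> [C mC B mB|y tau F stop A C sA mC]; first exact: measurable_time_changed_law.
  exact: time_changed_strong_markov.
by exists e0, (fun y x => mul y x), h; exact: time_changed_invariance.
Qed.

(** * The real Lévy process *)

Let chi z := ln (h z)^-1.

Let chiM x z : chi (mul x z) = chi x + chi z.
Proof. by rewrite /chi hM invfM lnM// posrE invr_gt0. Qed.

Let chiV x : chi (inv x) = - chi x.
Proof.
apply/eqP; rewrite -addr_eq0 -chiM mulV.
by have := chiM e0 e0; rewrite mul1 => /eqP; rewrite -subr_eq0 opprD addrA subrr sub0r oppr_eq0.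
Qed.

Let cchi : continuous chi.
Proof.
move=> z; apply: (@continuous_comp _ _ _ (fun z => (h z)^-1) (@ln R)).
  by apply: cvgV; [rewrite gt_eqF|exact: ch].
by apply: continuous_ln; rewrite invr_gt0.
Qed.

Let mchi C : path_measurable C -> path_measurable [set x : R -> E | C (chi \o x)].
Proof.
apply: (@sub_sigma_algebra_preimage _ _ (fun x : R -> E => chi \o x)).
  exact: smallest_sigma_algebra.
move=> _ [t [B [t0 mB ->]]]; apply: sub_sigma_algebra.
by exists t, (chi @^-1` B); split=> //; exact: (continuous_borel cchi).
Qed.

(** [chi] is a continuous homomorphism to the additive reals, so increments of the image are images
    of increments, and events of the image pull back to events of [L]. *)
Lemma levy_process_character : levy_process P (fun a b : R => a + b) (fun a : R => - a) 0
  (fun t w => ln (h (L t w))^-1).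
Proof.
have incrE t w : (fun s => increment (fun a b : R => a + b) (fun a : R => - a)
    (fun t w => chi (L t w)) t s w) = chi \o (fun s => increment mul inv L t s w).
  by apply/funext => s; rewrite /increment /= chiM chiV.
split.
- by move=> t B t0 mB; exact: (continuous_borel_fun cchi (mL t0)).
- by move=> w; exact: (cadlag_continuous cchi (cL w)).
- apply: filterS (levy_start hL) => w ->; rewrite -/(chi e0).
  by apply: (addrI (chi e0)); rewrite -chiM mul1 addr0.
- move=> t t0 A C FA mC.
  rewrite /law; under eq_set do rewrite incrE.
  apply: (levy_indep hL t0 _ (mchi mC)).
  move: A FA; apply: sub_sigma_algebra2 => _ [s [B [s0 st mB ->]]].
  by exists s, (chi @^-1` B); split=> //; exact: (continuous_borel cchi).
- move=> t t0 C mC.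
  rewrite /law; under eq_set do rewrite incrE.
  exact: (levy_stationary hL t0 (mchi mC)).
Qed.

End time_changed_levy.

Theorem proposition1p11 (R : realType) (E : metricType R)
    (mul : E -> E -> E) (inv : E -> E) (e0 : E) (h : E -> R)
    (d : measure_display) (Omega : measurableType d) (P : probability Omega R)
    (L : R -> Omega -> E)
    (hE : topological_group mul inv e0)
    (hlc : locally_compact [set: E])
    (hsep : separable E)
    (hh : positive_character mul h)
    (hL : levy_process P mul inv e0 L) :
  let X : E -> R -> Omega -> one_point_compactification E :=
    time_changed mul h L in
  let xi : R -> Omega -> R := fun t w => ln (h (L t w))^-1 in
  [/\ forall y, {ae P, forall w,
        lifetime y (fun t => X y t w) = phi h L y w +oo%E},
      general_self_similarity P X,
      invariance_components P X e0 (fun y x => mul y x) h,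
      levy_process P (fun a b : R => a + b) (fun a : R => - a) 0 xi &
      forall y, {ae P, forall w,
        lifetime y (fun t => X y t w) =
        ((h y)^-1%:E *
         \int[lebesgue_measure]_(s in [set s : R | (0 <= s)%R])
           (expR (xi s w))%:E)%E}].
Proof.
move=> X xi; split.
- exact: (time_changed_lifetime hE hlc hh hL).
- exact: (time_changed_general_self_similarity hE hlc hsep hh hL).
- exact: (time_changed_invariance hE hlc hh hL).
- exact: (levy_process_character hE hh hL).
- exact: (time_changed_lifetime_exp hE hlc hh hL).
Qed.
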